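(* Let $\mathcal A$ be a central essential arrangement of finitely many hyperplanes in $W=\mathbb R^\ell$, let $R=\mathbb R(w_F : F\in\mathcal F(\mathcal A))$, let $0\le p\le \ell$ and let $X\in L_p(\mathcal A)$. Then the $R$-linear map $$\psi_X\colon \mathrm{Fl}_p(\mathcal A_X)\to V(\mathcal A),\qquad \psi_X(\mathbf X)=\sum_{C\in\mathcal C(\mathcal A^X)} q^X_C\,\phi_p(\mathbf X\otimes C),$$ is one-to-one, and its image is the eigenspace of $K_{\mathcal A}\colon V(\mathcal A)\to V(\mathcal A)$ with eigenvalue $\lambda_X=\sum_{F\in\mathcal F(\mathcal A):\,|F|\ge X} w_F$.
   Context: **Arrangement and faces.** $\mathcal A$ is a finite set of linear hyperplanes in $W=\mathbb R^\ell$ whose common intersection is $\{0\}$ (central and essential). For each $H\in\mathcal A$ fix a linear form $f_H\in W^*$ with kernel $H$; the positive side of $H$ is $\{f_H>0\}$. $L(\mathcal A)$ is the set of all intersections of hyperplanes in $\mathcal A$ (including $W$, the empty intersection), ordered by reverse inclusion; $L_p(\mathcal A)$ is the set of elements of codimension $p$. A face $F$ is a nonempty set of points of $W$ on which all signs $F_H=\mathrm{sign}(f_H)\in\{0,+1,-1\}$ ($H\in\mathcal A$) are prescribed; $F$ is determined by $(F_H)_H$. $\mathcal F=\mathcal F(\mathcal A)$ is the set of faces, ordered by reverse inclusion of closures: $F\le G$ iff $\overline{F}^{\,cl}\supseteq G$. The codimension of $F$ is the codimension of $|F|$, the smallest element (as a subspace) of $L(\mathcal A)$ containing $F$. Chambers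 are the faces of codimension $0$; $\mathcal C(\mathcal A)$ is the set of chambers. The face product $FG$ is the face with $(FG)_H=F_H$ if $F_H\ne0$ and $(FG)_H=G_H$ otherwise. The antipodal face of $F$ is $\overline F=-F$. **Localization and restriction.** For $X\in L(\mathcal A)$, $\mathcal A_X=\{H\in\mathcal A: X\subseteq H\}$ (an arrangement in $W$), so $L(\mathcal A_X)=\{Y\in L(\mathcal A):Y\le X\}$, and $\mathcal A^X=\{H\cap X: H\in\mathcal A, X\not\subseteq H\}$ (an arrangement in $X$). One identifies $\mathcal F(\mathcal A^X)$ with $\{F\in\mathcal F(\mathcal A):|F|\ge X\}$ (i.e. $F\subseteq X$), and $\mathcal C(\mathcal A^X)$ with $\{F:|F|=X\}$. **Coefficients, modules, walk.** $R=\mathbb R(w_F: F\in\mathcal F(\mathcal A))$ is the field of rational functions in indeterminates $w_F$. $V(\mathcal A)$ is the free $R$-module on $\mathcal C(\mathcal A)$, and similarly $V(\mathcal A^X)$ on $\mathcal C(\mathcal A^X)$. The map $K=K_{\mathcal A}$ is the $R$-linear endomorphism of $V(\mathcal A)$ with $K(C)=\sum_{F\in\mathcal F(\mathcal A)}w_F\,FC$ for chambers $C$. **The vector $q^X$.** For $X\in L(\mathcal A)$, list the faces of $\mathcal A^X$ as $F_1,\dots,F_N$, $N=|\mathcal F(\mathcal A^X)|$. For $C\in\mathcal C(\mathcal A^X)$, $$q^X_C=\sum_{\substack{\sigma\in S_N:\\ C=F_{\sigma(1)}\cdots F_{\sigma(N)}}}\ \prod_{p=1}^N\Big(\sum_{i=p}^N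 w_{F_{\sigma(i)}}\Big)^{-1}\in R.$$ **Flags.** A $p$-flag in $L(\mathcal A)$ is a chain $\mathbf X=(X_0<X_1<\cdots<X_p)$ with $X_i\in L_i(\mathcal A)$. $\mathrm{Fl}_p(\mathcal A)$ is the free $R$-module on $p$-flags in $L(\mathcal A)$ modulo the relations $\sum_{Y: X_{i-1}<Y<X_{i+1}}(X_0<\cdots<X_{i-1}<Y<X_{i+1}<\cdots<X_p)=0$, for each flag $(X_0<\cdots<X_p)$ and each $0<i<p$. For $X\in L_p(\mathcal A)$, $\mathrm{Fl}_p(\mathcal A_X)$ is the same construction for $\mathcal A_X$; its generators are the $p$-flags ending at $X_p=X$. A $p$-flag of faces is $\mathbf F=(F_0<\cdots<F_p)$ with $F_i\in\mathcal F(\mathcal A)$ of codimension $i$; put $|\mathbf F|=(|F_0|<\cdots<|F_p|)$ and $$b(\mathbf F)=F_p(F_{p-1}-\overline{F_{p-1}})(F_{p-2}-\overline{F_{p-2}})\cdots(F_0-\overline{F_0})\in V(\mathcal A)$$ (product expanded bilinearly with the face product; $b(\mathbf F)=F_0$ for $p=0$). **Signs.** Let $Z_{\mathcal A}=\sum_{H}[-f_H,f_H]\subset W^*$ (Minkowski sum). Its faces are $\hat F=\sum_H F_Hf_H+Z_{\mathcal A_{|F|}}$, $F\in\mathcal F(\mathcal A)$, and $F\le G$ iff $\hat F\subseteq\hat G$. Fix an orientation of each face of $Z_{\mathcal A}$ so that parallel faces have the same orientation (equivalently, an orientation of the annihilator in $W^*$ of each $X\in L(\mathcal A)$), otherwise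 arbitrary. For a covering relation $F<G$ (so $\hat F$ is a facet of $\hat G$) let $\varepsilon(F,G)=+1$ if the orientation of $\hat F$ agrees with the boundary orientation induced from $\hat G$ (outward normal first), and $-1$ otherwise. Let $\varepsilon(\mathbf F)=\prod_{i=0}^{p-1}\varepsilon(F_i,F_{i+1})$. **The map $\phi_p$.** $\phi_p\colon\bigoplus_{X\in L_p(\mathcal A)}\mathrm{Fl}_p(\mathcal A_X)\otimes_R V(\mathcal A^X)\to V(\mathcal A)$ is the (known to be well-defined) $R$-linear map with $\phi_p(\mathbf X\otimes F)=\varepsilon(\mathbf F)\,b(\mathbf F)$, where $\mathbf F$ is any $p$-flag of faces with $|\mathbf F|=\mathbf X$ and $F_p=F$. *)

(* Defs.v *)
From HB Require Import structures.
From mathcomp Require Import all_boot all_order all_algebra perm.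
From mathcomp Require Import boolp classical_sets reals topology normedtype.
From mathcomp Require mpoly.
(* the notations of mpoly clash with those of the analysis library *)
Import -(notations) mpoly.

Set Implicit Arguments.
Unset Strict Implicit.
Unset Printing Implicit Defensive.

Import Order.TTheory GRing.Theory Num.Theory numFieldNormedType.Exports.
Local Open Scope ring_scope.

Section QuotientSpace.
Variables (K : fieldType) (V : vectType K) (U : {vspace V}).
Local Open Scope quotient_scope.

Definition quotv := Quotient.quot (U : zmodClosed V).

HB.instance Definition _ := GRing.Zmodule.on quotv.

Definition quotv_class (v : V) : quotv := \pi_quotv v.

Lemma quotv_classP (u v : V) :
  quotv_class u = quotv_class v <-> u - v \in U.
Proof. by rewrite (rwP eqP) /quotv_class -Quotient.idealrBE. Qed.

Lemma quotv_class_zmod : zmod_morphism quotv_class.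
Proof. by move=> u v; rewrite /quotv_class !piE. Qed.

Definition quotv_scale (a : K) (x : quotv) : quotv :=
  quotv_class (a *: repr x).

Lemma quotv_scale_class a v :
  quotv_scale a (quotv_class v) = quotv_class (a *: v).
Proof.
apply/quotv_classP; rewrite -scalerBr rpredZ //.
by apply/quotv_classP; rewrite /quotv_class reprK.
Qed.

Lemma quotv_classE (x : quotv) : quotv_class (repr x) = x.
Proof. by rewrite /quotv_class reprK. Qed.

Lemma quotv_classD u v :
  quotv_class (u + v) = quotv_class u + quotv_class v.
Proof. by rewrite /quotv_class !piE. Qed.

Fact quotv_scaleA a b x :
  quotv_scale a (quotv_scale b x) = quotv_scale (a * b) x.
Proof. by rewrite -[x]quotv_classE !quotv_scale_class scalerA. Qed.

Fact quotv_scale1 : left_id 1 quotv_scale.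
Proof. by move=> x; rewrite -[x]quotv_classE quotv_scale_class scale1r. Qed.

Fact quotv_scaleDr : right_distributive quotv_scale +%R.
Proof.
move=> a x y; rewrite -[x]quotv_classE -[y]quotv_classE.
by rewrite -quotv_classD !quotv_scale_class -quotv_classD scalerDr.
Qed.

Fact quotv_scaleDl x : {morph quotv_scale^~ x : a b / a + b}.
Proof.
move=> a b; rewrite -[x]quotv_classE.
by rewrite !quotv_scale_class -quotv_classD scalerDl.
Qed.

HB.instance Definition _ := GRing.Zmodule_isLmodule.Build K quotv
  quotv_scaleA quotv_scale1 quotv_scaleDr quotv_scaleDl.

End QuotientSpace.

Inductive sign := Neg | Zero | Pos.

Definition sign_code (s : sign) : option bool :=
  match s with Neg => Some false | Zero => None | Pos => Some true end.
Definition sign_decode (o : option bool) : sign :=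
  match o with Some false => Neg | None => Zero | Some true => Pos end.
Lemma sign_codeK : cancel sign_code sign_decode.
Proof. by case. Qed.

HB.instance Definition _ := Finite.copy sign (can_type sign_codeK).

Definition sign_opp (s : sign) : sign :=
  match s with Neg => Pos | Zero => Zero | Pos => Neg end.

Definition sign_of (R : realType) (x : R) : sign :=
  if x == 0 then Zero else if 0 < x then Pos else Neg.

Definition sign_val (R : realType) (s : sign) : R :=
  match s with Neg => -1 | Zero => 0 | Pos => 1 end.

Section Arrangement.
Variables (R : realType) (l : nat) (I : finType).
Local Notation W := 'rV[R]_l.
Local Notation Wdual := 'Hom('rV[R]_l, R^o).
Variable f : I -> Wdual.

Definition hyp (i : I) : {vspace W} := lker (f i).

(* [I] indexes the finite set of hyperplanes, [f i] being the chosen form. *)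
Definition is_arrangement : Prop := (forall i, f i != 0) /\ injective hyp.

Definition is_essential : Prop := (\bigcap_(i in I) hyp i = 0)%VS.

(* The intersection lattice of the subarrangement indexed by [S]; the empty
   intersection is [fullv]. *)
Definition lattice (S : {set I}) : seq {vspace W} :=
  [seq (\bigcap_(i in T) hyp i)%VS | T : {set I} in powerset S].

Definition codim (X : {vspace W}) : nat := (l - \dim X)%N.

(* The strict order of the lattice is reverse inclusion. *)
Definition llt (X Y : {vspace W}) : bool := (Y <= X)%VS && (Y != X).

(* The localization at [X], as a set of indices. *)
Definition loc (X : {vspace W}) : {set I} := [set i | (X <= hyp i)%VS].

Definition signs (x : W) : {ffun I -> sign} := [ffun i => sign_of (f i x : R)].

Definition is_face (s : {ffun I -> sign}) : bool := `[< exists x, signs x = s >].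

Definition face : finType := {s : {ffun I -> sign} | is_face s}.

Definition points (F : face) : set W := [set x | signs x = val F]%classic.

(* [|F|]; see [suppP]. *)
Definition supp (F : face) : {vspace W} :=
  (\bigcap_(i | val F i == Zero) hyp i)%VS.

Lemma sign_of_eq0 (x : R) : (sign_of x == Zero) = (x == 0).
Proof. by rewrite /sign_of; case: (x == 0) => //; case: (0 < x). Qed.

Lemma points_hyp (F : face) x i :
  points F x -> (x \in hyp i) = (val F i == Zero).
Proof. by move=> <-; rewrite ffunE sign_of_eq0 memv_ker. Qed.

Lemma face_point (F : face) : exists x, points F x.
Proof. by have /asboolP[x Fx] := valP F; exists x. Qed.

(* [supp F] is the smallest element of the lattice containing [F]. *)
Lemma suppP (F : face) :
  [/\ supp F \in lattice [set: I],
      forall x, points F x -> x \in supp F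
    & forall X, X \in lattice [set: I] ->
      (forall x, points F x -> x \in X) -> (supp F <= X)%VS].
Proof.
split.
- apply/fintype.imageP; exists [set i | val F i == Zero].
    by rewrite inE finset.subsetT.
  by apply: eq_bigl => i; rewrite inE.
- move=> x Fx; rewrite memvE; apply/subv_bigcapP => i Fi.
  by rewrite -memvE (points_hyp i Fx).
- move=> _ /fintype.imageP[T _ ->] FT; apply/subv_bigcapP => i iT.
  apply: (bigcapv_inf i) => //; have [x Fx] := face_point F.
  rewrite -(points_hyp i Fx); move: (FT x Fx); rewrite memvE.
  by move=> /subv_bigcapP/(_ i iT); rewrite -memvE.
Qed.

Definition fle (F G : face) : bool :=
  `[< (points G `<=` closure (points F))%classic >].

Definition flt (F G : face) : bool := fle F G && (F != G).

Definition smul (s t : {ffun I -> sign}) : {ffun I -> sign} :=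
  [ffun i => if s i == Zero then t i else s i].

Lemma smul_is_face (F G : face) : is_face (smul (val F) (val G)).
Proof.
have [x Fx] := face_point F; have [y Gy] := face_point G.
pose a i : R := `|f i x : R| / (`|f i y : R| + 1).
have a_gt0 i : f i x != 0 -> 0 < a i.
  by move=> fx; rewrite divr_gt0 ?normr_gt0 // ltr_wpDl.
pose e : R := \big[Order.min/1]_(i | f i x != 0) a i.
have e_gt0 : 0 < e by apply: lt_bigmin => // i; apply: a_gt0.
have e_small i : f i x != 0 -> e * `|f i y : R| < `|f i x : R|.
  move=> fx; have : e <= a i by apply: bigmin_le_cond.
  rewrite /a ler_pdivlMr ?ltr_wpDl // mulrDr mulr1 => /(lt_le_trans _); apply.
  by rewrite ltrDl.
apply/asboolP; exists (x + e *: y); apply/ffunP => i.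
rewrite ffunE -Fx -Gy !ffunE sign_of_eq0.
have -> : (f i (x + e *: y) : R) = (f i x : R) + e * (f i y : R).
  by rewrite linearD linearZ.
have [->|fx] := eqVneq (f i x) 0.
  rewrite add0r /sign_of mulf_eq0 gt_eqF //= pmulr_rgt0 //.
have := e_small i fx; rewrite -{1}(gtr0_norm e_gt0) -normrM.
move: (f i x : R) (e * (f i y : R)) fx => u v u0 uv.
have uv0 : u + v != 0.
  by apply: contraTneq uv => /eqP; rewrite addr_eq0 => /eqP->; rewrite normrN ltxx.
rewrite /sign_of (negPf u0) (negPf uv0); congr (if _ then _ else _).
have [u_gt0|u_le0] := ltP 0 u.
  move: uv; rewrite (gtr0_norm u_gt0) ltr_norml => /andP[uv _].
  by rewrite -ltrBlDl sub0r.
move: uv; rewrite (ler0_norm u_le0) ltr_norml => /andP[_ uv].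
by apply/negbTE; rewrite -leNgt -lerBrDl sub0r ltW.
Qed.

Definition fmul (F G : face) : face := Sub _ (smul_is_face F G).

Lemma signs0_is_face : is_face (signs 0).
Proof. by apply/asboolP; exists 0. Qed.

(* The face [{0}] (when the arrangement is essential), unit of the product. *)
Definition fone : face := Sub _ signs0_is_face.

Lemma sopp_is_face (F : face) : is_face [ffun i => sign_opp (val F i)].
Proof.
have [x Fx] := face_point F; apply/asboolP; exists (- x); apply/ffunP => i.
rewrite !ffunE -Fx ffunE linearN /sign_of oppr_eq0 oppr_gt0.
by case: ltgtP.
Qed.

Definition fopp (F : face) : face := Sub _ (sopp_is_face F).

Definition is_chamber (F : face) : bool := codim (supp F) == 0%N.

Definition chamber : finType := {F : face | is_chamber F}.

Lemma fmul_is_chamber (F : face) (C : chamber) : is_chamber (fmul F (val C)).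
Proof.
have := valP C; rewrite /is_chamber /codim !subn_eq0 => /leq_trans; apply.
apply/dimvS/subv_bigcapP => i; rewrite ffunE => Hi.
by apply: (bigcapv_inf i) => //; move: Hi; case: ifP => // /negPf->.
Qed.

Definition cmul (F : face) (C : chamber) : chamber := Sub _ (fmul_is_chamber F C).

(* The chambers of the restriction to [X], as faces of the arrangement. *)
Definition chamber_on (X : {vspace W}) : finType := {F : face | supp F == X}.

(* The faces of the restriction to [X], as faces of the arrangement. *)
Definition faces_on (X : {vspace W}) : {set face} := [set F | (supp F <= X)%VS].

Definition ratf : fieldType := {fraction (mpoly #|face| R)}.

Definition w (F : face) : ratf := tofrac (mpolyX R (mnm1 (enum_rank F))).

Definition free_mod (T : finType) : vectType ratf := {ffun T -> ratf^o}.

Definition gen (T : finType) (x : T) : free_mod T := [ffun y => (y == x)%:R].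

Definition V : vectType ratf := free_mod chamber.

Definition Kfun (v : V) : V :=
  \sum_(C : chamber) v C *: \sum_(F : face) w F *: gen (cmul F C).

Fact Kfun_linear : linear Kfun.
Proof.
move=> a u v; rewrite /Kfun scaler_sumr -big_split /=; apply: eq_bigr => C _.
by rewrite !ffunE scalerDl scalerA.
Qed.

HB.instance Definition _ := GRing.isLinear.Build ratf V V _ Kfun Kfun_linear.

Definition K : 'End(V) := linfun Kfun.

Definition lambda (X : {vspace W}) : ratf := \sum_(F in faces_on X) w F.

Definition q (X : {vspace W}) (C : chamber_on X) : ratf :=
  let N := #|faces_on X| in
  let Fs := fun i : 'I_N => enum_val i in
  \sum_(s : 'S_N | val C == \big[fmul/fone]_(i < N) Fs (s i))
    \prod_(p < N) (\sum_(i < N | (p <= i)%N) w (Fs (s i)))^-1.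

Section Flags.
Variables (p : nat) (S : {set I}).

Definition is_flag (t : p.+1.-tuple (seq_sub (lattice S))) : bool :=
  [forall i : 'I_p.+1, codim (val (tnth t i)) == i]
  && sorted llt [seq val X | X <- t].

Definition flag : finType := {t : p.+1.-tuple (seq_sub (lattice S)) | is_flag t}.

Definition flag_at (t : flag) (i : 'I_p.+1) : {vspace W} :=
  val (tnth (val t) i).

(* The flags obtained from [t] by replacing its [i]-th term [X_i] with a [Y]
   such that X_(i-1) < Y < X_(i+1); such a [Y] always has codimension [i]. *)
Definition relator (t : flag) (i : 'I_p.+1) : free_mod flag :=
  \sum_(u : flag | [forall j, (j != i) ==> (flag_at u j == flag_at t j)]) gen u.

Definition relators : seq (free_mod flag) :=
  [seq relator t i | t <- enum flag, i <- [seq i : 'I_p.+1 <- enum 'I_p.+1 | (0 < i < p)%N]].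

Definition Fl : lmodType ratf := quotv <<relators>>%VS.

Definition flag_class (t : flag) : Fl := quotv_class <<relators>>%VS (gen t).

End Flags.

Definition is_fflag (p : nat) (t : p.+1.-tuple face) : bool :=
  [forall i : 'I_p.+1, codim (supp (tnth t i)) == i] && sorted flt t.

(* The face product extended bilinearly to the free module on all faces. *)
Definition amul (u v : free_mod face) : free_mod face :=
  \sum_(F : face) \sum_(G : face) (u F * v G) *: gen (fmul F G).

(* [F_0] being a chamber, all the faces occurring in the product are chambers,
   so that restricting the coefficients to the chambers loses nothing. *)
Definition b (p : nat) (t : p.+1.-tuple face) : V :=
  let d := [seq gen F - gen (fopp F) | F <- rev (take p t)] in
  let u := foldl amul (gen (tnth t ord_max)) d in
  [ffun C : chamber => u (val C)].

Definition zonotope (S : {set I}) : set Wdual :=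
  [set g | exists c : I -> R, (forall i, -1 <= c i <= 1)
                           /\ g = \sum_(i in S) c i *: f i]%classic.

Definition zface (F : face) : set Wdual :=
  [set g | exists2 z, zonotope (loc (supp F)) z
                    & g = \sum_i sign_val R (val F i) *: f i + z]%classic.

Definition restr (X : {vspace W}) (g : Wdual) : Wdual := (g \o projv X)%VF.

Fact restr_linear X : linear (restr X).
Proof. by move=> a g h; rewrite /restr comp_lfunDl comp_lfunZl. Qed.

HB.instance Definition _ X :=
  GRing.isLinear.Build R Wdual Wdual _ (restr X) (restr_linear X).

(* The annihilator of [X]; see [mem_ann]. *)
Definition ann (X : {vspace W}) : {vspace Wdual} := lker (linfun (restr X)).

Lemma mem_ann X g : (g \in ann X) = (X <= lker g)%VS.
Proof.
rewrite memv_ker lfunE /=; apply/eqP/subvP => [g0 x Xx|gX].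
  have /lfunP/(_ x) := g0; rewrite comp_lfunE projv_id // zero_lfunE => gx0.
  by rewrite memv_ker gx0.
apply/lfunP => x; rewrite comp_lfunE zero_lfunE; apply/eqP.
by rewrite -memv_ker gX // memv_proj.
Qed.

(* An orientation of [U], given by its predicate [pos] of positively oriented
   bases (in dimension 0 the empty basis may be positive or not). *)
Definition is_orientation (U : {vspace Wdual}) (pos : pred (seq Wdual)) : Prop :=
  forall c d : (\dim U).-tuple Wdual, basis_of U c -> basis_of U d ->
    pos d = if 0 < \det (\matrix_(i, j) coord c i (tnth d j)) then pos c
            else ~~ pos c.

(* [o X] orients the annihilator of [X], hence all the faces [zface F] with
   [supp F = X], which are parallel to it. *)
Definition orients (o : {vspace W} -> pred (seq Wdual)) : Prop :=
  forall X, X \in lattice [set: I] -> is_orientation (ann X) (o X).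

Variable o : {vspace W} -> pred (seq Wdual).

(* [v] points out of [zface G] across its facet [zface F]. *)
Definition outward (F G : face) (v : Wdual) : Prop :=
  (exists x y, [/\ zface F x, zface G y & v = x - y]) /\ v \notin ann (supp F).

Definition agree (F G : face) : bool :=
  `[< exists v c, [/\ outward F G v, basis_of (ann (supp F)) c
                    & o (supp F) c = o (supp G) (v :: c)] >].

Definition eps (F G : face) : ratf := if agree F G then 1 else -1.

Definition feps (p : nat) (t : p.+1.-tuple face) : ratf :=
  \prod_(i < p) eps (tnth t (widen_ord (leqnSn p) i)) (tnth t (lift ord0 i)).

Section Phi.
Variables (p : nat) (X : {vspace W}).
Local Notation FlX := (Fl p (loc X)).
Local Notation VX := (free_mod (chamber_on X)).

(* The component at [X] of [phi_p], as a bilinear map on Fl_p(A_X) x V(A^X). *)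
Definition is_phi (g : {bilinear FlX -> VX -> V}) : Prop :=
  forall (t : flag p (loc X)) (C : chamber_on X) (u : p.+1.-tuple face),
    is_fflag u -> (forall i, supp (tnth u i) = flag_at t i) ->
    tnth u ord_max = val C ->
    g (flag_class t) (gen C) = feps u *: b u.

Definition bilin0 (x : FlX) (y : VX) : V := 0.

Fact bilin0_bilinear : bilinear_for *:%R *:%R bilin0.
Proof. by split=> z a x y; rewrite /bilin0 /= scaler0 addr0. Qed.

HB.instance Definition _ :=
  bilinear_isBilinear.Build ratf FlX VX V _ _ bilin0 bilin0_bilinear.

(* The map characterized by [is_phi]. It is known to exist, so that the default
   value 0 is never used, and it is unique: for all [t] and [C] there is a flag
   of faces over [t] ending at [C], and the classes of flags span. *)
Definition phi : {bilinear FlX -> VX -> V} :=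
  if pselect (exists g, is_phi g) is left h then projT1 (cid h)
  else (bilin0 : {bilinear FlX -> VX -> V}).

Definition psi (x : FlX) : V := \sum_(C : chamber_on X) q C *: phi x (gen C).

Fact psi_linear : linear psi.
Proof.
move=> a x y; rewrite /psi scaler_sumr -big_split /=; apply: eq_bigr => C _.
by rewrite linearPl scalerDr !scalerA mulrC.
Qed.

HB.instance Definition _ := GRing.isLinear.Build ratf FlX V _ psi psi_linear.

End Phi.

End Arrangement.

(* Main.v *)
From HB Require Import structures.
Require Import Defs.
From mathcomp Require Import all_boot all_order all_algebra perm.
From mathcomp Require Import boolp classical_sets reals topology normedtype.
From mathcomp Require Import zify ring lra.
From mathcomp Require mpoly.
Import -(notations) mpoly.
Import Order.TTheory GRing.Theory Num.Theory numFieldNormedType.Exports.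
Local Open Scope ring_scope.

Set Implicit Arguments.
Unset Strict Implicit.
Unset Printing Implicit Defensive.

(** Let [X] have codimension [p], let [X_0 < ... < X_p = X] be a flag and let [C]
    be a face with support [X]. The element [phi_p] of the flag and of [C] is, up
    to sign, the product C (G_(p-1) - -G_(p-1)) ... (G_0 - -G_0), where [G_i] is
    any face with support [X_i]. Expanding it gives the sum of the chambers [F_0]
    over all the flags of faces [F_0 < ... < F_p = C] that have the given supports,
    each with its sign [eps] ([flag_sum], [flag_sum_diff_prod]). In this form no choice
    is left, and [phi_p] respects the relations between flags because exactly two
    faces lie between a face and one of codimension two in it, with opposite
    signs ([diamond], [flag_sum_kills]). The signs become tractable once they are
    read off linear forms instead of outward vectors of zonotopes ([agreeP]).

    The walk acts on these elements through their end [C] only. Left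
    multiplication by a face inside [X] moves [C]; a face not inside [X] kills
    the product, since one of the factors [G_i - -G_i] then has no effect
    ([diff_prod_vanish], [flag_sum_walk]). Hence an element of the eigenspace of
    [X] arises from each stationary vector of the walk restricted to [X], and
    sampling the faces of [X] without replacement is stationary: in a product of
    all the faces, a face put in front absorbs its later occurrence
    ([draw_eigen], [eigvecP]).

    These eigenvectors span. If [E] is a wall shared by two faces [C] and [C'] of
    support [X], the difference of the elements of [C] and [C'] is an element of a
    longer flag that ends at [E]. Going along galleries and arguing by induction
    on the dimension, all the elements of a flag of [X] are congruent to a
    multiple of the eigenvector of this flag ([gallery_step], [flag_sum_spanned]).
    Distinct subspaces have distinct eigenvalues, so that each eigenspace is
    spanned by its own eigenvectors ([eigenspace_span]).

    Injectivity is proved on the dual side: every function on the flags that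
    respects the relations comes from a function on the chambers ([represent]).
    Given a hyperplane through [X], such a function is determined by its values
    on the flags whose last but one term [Y] is not in the hyperplane
    ([kills_determined]); by induction each term [Y] has its own function on
    chambers, a sum of functions that depend only on the signs of [p - 1]
    independent hyperplanes through [Y], and it vanishes on the flags through the other terms because a
    product of [p - 1] differences kills the functions of fewer signs
    ([diff_prod_few]).

    The coefficients enter only through the fact that distinct sets of faces have
    distinct total weights, so the argument is carried out over an arbitrary
    field with such weights. *)

(** * Sign vectors and the face product *)

Section Faces.
Variables (R : realType) (l : nat) (I : finType).
Local Notation W := 'rV[R]_l.
Local Notation Wdual := 'Hom('rV[R]_l, R^o).
Variable f : I -> Wdual.
Local Notation face := (face f).
Local Notation hyp := (hyp f).
Implicit Types (F G C D E : face) (X Y Z : {vspace W}).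

Definition sgn F (i : I) : sign := val F i.

Lemma face_eqP F G : (forall i, sgn F i = sgn G i) -> F = G.
Proof. by move=> FG; apply/val_inj/ffunP. Qed.

Lemma sgnM F G i :
  sgn (fmul F G) i = if sgn F i == Zero then sgn G i else sgn F i.
Proof. by rewrite /sgn /= ffunE. Qed.

Lemma sgn_opp F i : sgn (fopp F) i = sign_opp (sgn F i).
Proof. by rewrite /sgn /= ffunE. Qed.

Lemma sign_opp0 s : (sign_opp s == Zero) = (s == Zero).
Proof. by case: s. Qed.

Lemma sgn1 i : sgn (fone f) i = Zero.
Proof.
by rewrite /sgn /= ffunE; apply/eqP; rewrite sign_of_eq0 linear0.
Qed.

Lemma fmulA F G E : fmul F (fmul G E) = fmul (fmul F G) E.
Proof.
apply: face_eqP => i; rewrite !sgnM.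
by case F0: (sgn F i == Zero); rewrite ?F0.
Qed.

Lemma fmulid F : fmul F F = F.
Proof. by apply: face_eqP => i; rewrite sgnM; case: ifP. Qed.

Lemma fmul_aba F G : fmul (fmul F G) F = fmul F G.
Proof.
apply: face_eqP => i; rewrite !sgnM.
by case F0: (sgn F i == Zero); rewrite ?F0 //; case: eqP => // ->; rewrite (eqP F0).
Qed.

Lemma mem_loc X i : (i \in loc f X) = (X <= hyp i)%VS.
Proof. by rewrite inE. Qed.

Lemma sgn_eq0 F i : (sgn F i == Zero) = (i \in loc f (supp F)).
Proof.
rewrite mem_loc; apply/idP/idP => [Fi|Xi].
  exact: (bigcapv_inf i).
have [x Fx] := face_point F; rewrite -(points_hyp i Fx).
by have [_ /(_ x Fx) xF _] := suppP F; apply: (subvP Xi).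
Qed.

Lemma supp_le F X : X \in lattice f [set: I] ->
  (supp F <= X)%VS = (loc f X \subset loc f (supp F)).
Proof.
move=> /fintype.imageP[T _ XT]; apply/idP/fintype.subsetP => [FX i|XF].
  by rewrite !mem_loc; apply: subv_trans.
rewrite XT; apply/subv_bigcapP => i iT; rewrite -mem_loc; apply: XF.
by rewrite mem_loc XT; apply: (bigcapv_inf i).
Qed.

Lemma lattice_loc X : X \in lattice f [set: I] ->
  X = (\bigcap_(i in loc f X) hyp i)%VS.
Proof.
move=> /fintype.imageP[T _ XT]; apply/eqP; rewrite eqEsubv; apply/andP; split.
  by apply/subv_bigcapP => i; rewrite mem_loc.
rewrite {2}XT; apply/subv_bigcapP => i iT; apply: (bigcapv_inf i) => //.
by rewrite mem_loc XT; apply: (bigcapv_inf i).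
Qed.

Lemma lattice_sub X Y : X \in lattice f [set: I] -> Y \in lattice f [set: I] ->
  (X <= Y)%VS = (loc f Y \subset loc f X).
Proof.
move=> LX LY; apply/idP/fintype.subsetP => [XY i|YX].
  by rewrite !mem_loc; apply: subv_trans.
rewrite (lattice_loc LY); apply/subv_bigcapP => i /YX.
by rewrite mem_loc.
Qed.

Lemma lattice_eq X Y : X \in lattice f [set: I] -> Y \in lattice f [set: I] ->
  loc f X = loc f Y -> X = Y.
Proof. by move=> /lattice_loc {2}-> /lattice_loc {2}-> ->. Qed.

Lemma supp_lattice F : supp F \in lattice f [set: I].
Proof. by case: (suppP F). Qed.

Lemma lattice_cap (T : {set I}) :
  (\bigcap_(i in T) hyp i)%VS \in lattice f [set: I].
Proof. by apply/fintype.imageP; exists T; rewrite // inE finset.subsetT. Qed.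

Lemma latticeS X (S : {set I}) : X \in lattice f S -> X \in lattice f [set: I].
Proof.
by move=> /fintype.imageP[T _ ->]; apply: lattice_cap.
Qed.

Lemma lattice_locS X Y : X \in lattice f [set: I] -> (Y <= X)%VS ->
  X \in lattice f (loc f Y).
Proof.
move=> /lattice_loc XE YX; apply/fintype.imageP; exists (loc f X) => //.
rewrite inE; apply/fintype.subsetP => i; rewrite !mem_loc.
exact: subv_trans.
Qed.

Lemma lattice_capH X i : X \in lattice f [set: I] ->
  (X :&: hyp i)%VS \in lattice f [set: I].
Proof.
move=> /lattice_loc ->.
rewrite (_ : (_ :&: _)%VS = \bigcap_(j in i |: loc f X) hyp j)%VS.
  exact: lattice_cap.
apply/eqP; rewrite eqEsubv; apply/andP; split.
  apply/subv_bigcapP => j; rewrite !inE => /orP[/eqP->|jX].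
    exact: capvSr.
  by apply: subv_trans (capvSl _ _) _; apply: (bigcapv_inf j); rewrite // inE.
rewrite subv_cap; apply/andP; split; last first.
  by apply: (bigcapv_inf i); rewrite // !inE eqxx.
apply/subv_bigcapP => j jX; apply: (bigcapv_inf j) => //.
by rewrite !inE orbC; rewrite inE in jX; rewrite jX.
Qed.

Lemma loc_supp_mul F G :
  loc f (supp (fmul F G)) = (loc f (supp F) :&: loc f (supp G))%SET.
Proof.
apply/setP => i; rewrite finset.in_setI -!sgn_eq0 sgnM.
by case: ifP => // ->.
Qed.

Lemma loc_supp_opp F : loc f (supp (fopp F)) = loc f (supp F).
Proof. by apply/setP => i; rewrite -!sgn_eq0 sgn_opp sign_opp0. Qed.

Lemma supp_opp F : supp (fopp F) = supp F.
Proof. by apply: lattice_eq (loc_supp_opp F); apply: supp_lattice. Qed.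

(** The hyperplanes that contain a product of faces are those that contain all
    its factors. *)
Lemma supp_mul F G : (supp F <= supp G)%VS -> supp (fmul F G) = supp G.
Proof.
move=> FG; apply: lattice_eq; rewrite ?supp_lattice // loc_supp_mul.
apply/finset.setIidPr; by rewrite -lattice_sub ?supp_lattice.
Qed.

Lemma supp_leMl F G : (supp F <= supp (fmul F G))%VS.
Proof.
by rewrite lattice_sub ?supp_lattice // loc_supp_mul finset.subsetIl.
Qed.

Lemma supp_mul_le F G X : X \in lattice f [set: I] ->
  (supp (fmul F G) <= X)%VS = (supp F <= X)%VS && (supp G <= X)%VS.
Proof. by move=> LX; rewrite !supp_le // loc_supp_mul finset.subsetI. Qed.

Definition pt F : W := projT1 (cid (face_point F)).

Lemma ptP F : points F (pt F).
Proof. by rewrite /pt; case: cid. Qed.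

Lemma sgn_pt F x i : points F x -> sgn F i = sign_of (f i x : R).
Proof. by rewrite /sgn => <-; rewrite ffunE. Qed.

Definition face_of (x : W) : face :=
  Sub (signs f x) (introT (asboolP _) (ex_intro _ x erefl)).

Lemma points_face_of x : points (face_of x) x.
Proof. by []. Qed.

Lemma sgn_face_of x i : sgn (face_of x) i = sign_of (f i x : R).
Proof. exact/sgn_pt/points_face_of. Qed.

Lemma points_supp F x : points F x -> x \in supp F.
Proof. by have [_ h _] := suppP F => /h. Qed.

Lemma loc_face_of x i : (i \in loc f (supp (face_of x))) = ((f i x : R) == 0).
Proof. by rewrite -sgn_eq0 sgn_face_of sign_of_eq0. Qed.

Lemma supp_face_of x X : X \in lattice f [set: I] ->
  (supp (face_of x) <= X)%VS = (x \in X).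
Proof.
move=> LX; apply/idP/idP => [|xX].
  by move=> /subvP; apply; apply/points_supp/points_face_of.
rewrite supp_le //; apply/fintype.subsetP => i; rewrite mem_loc => /subvP/(_ x xX).
by rewrite memv_ker loc_face_of.
Qed.

(** A product of faces of [X], one of them off each of the hyperplanes that do
    not contain [X]. *)
Lemma face_on X : X \in lattice f [set: I] -> exists F, supp F = X.
Proof.
move=> LX.
suff [F FX] : exists F, loc f (supp F) = loc f X.
  by exists F; apply: lattice_eq FX; rewrite ?supp_lattice.
suff [F [FX FN]] : exists F, loc f X \subset loc f (supp F) /\
    (forall i, i \in enum I -> i \notin loc f X -> i \notin loc f (supp F)).
  exists F; apply/setP => i; apply/idP/idP => [|iX]; last exact: (fintype.subsetP FX).
  by apply: contraTT => /FN; apply; rewrite mem_enum.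
elim: (enum I) => [|i s [F [FX FN]]].
  by exists (fone f); split=> //; apply/fintype.subsetP => i _; rewrite -sgn_eq0 sgn1.
have [iX|iX] := boolP (i \in loc f X).
  exists F; split=> // j; rewrite inE => /predU1P[->|]; last exact: FN.
  by rewrite iX.
move: (iX); rewrite mem_loc => /subvPn[x xX xi].
exists (fmul F (face_of x)); rewrite loc_supp_mul; split.
  by rewrite finset.subsetI FX -supp_le // supp_face_of.
move=> j; rewrite inE finset.in_setI => /predU1P[-> _|js jX].
  by rewrite loc_face_of -memv_ker (negPf xi) andbF.
by rewrite (negPf (FN _ _ _)).
Qed.

Definition cover X Y : bool := (X <= Y)%VS && (\dim Y == (\dim X).+1).

Lemma coverS X Y : cover X Y -> (X <= Y)%VS. Proof. by case/andP. Qed.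

Lemma cover_capH X (h : Wdual) : ~~ (X <= lker h)%VS -> cover (X :&: lker h) X.
Proof.
move=> Xh; rewrite /cover capvSl /= -(limg_ker_dim h X) -[(\dim _).+1]addn1.
rewrite eqn_add2l eqn_leq; apply/andP; split.
  by apply: leq_trans (dimvS (subvf _)) _; rewrite dimvf.
by rewrite lt0n dimv_eq0 -lkerE.
Qed.

Lemma cover_eqcap X Y (h : Wdual) : cover X Y -> (X <= lker h)%VS ->
  ~~ (Y <= lker h)%VS -> (Y :&: lker h)%VS = X.
Proof.
move=> /andP[XY dXY] Xh Yh; apply/eqP.
rewrite eq_sym eqEdim subv_cap XY Xh /=.
by have /andP[_ /eqP] := cover_capH Yh; rewrite (eqP dXY) => -[->].
Qed.

(** The subspace [Y] is spanned by its hyperplane [X] and any point off [X]. *)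
Lemma cover_in X Y (h : Wdual) x : cover X Y -> (X <= lker h)%VS -> x \in Y ->
  x \notin X -> (h x : R) = 0 -> (Y <= lker h)%VS.
Proof.
move=> XY Xh xY xX hx; apply: contraNT xX => Yh.
by rewrite -(cover_eqcap XY Xh Yh) memv_cap xY memv_ker hx eqxx.
Qed.

Lemma coverN X Y : cover X Y -> exists2 x, x \in Y & x \notin X.
Proof.
move=> /andP[XY /eqP dXY]; apply/subvPn; apply/negP => /dimvS.
by rewrite dXY ltnn.
Qed.

Lemma cover_loc X Y : X \in lattice f [set: I] -> cover X Y ->
  exists2 i, i \in loc f X & i \notin loc f Y.
Proof.
move=> LX XY; have [x xY xX] := coverN XY.
have : ~~ [forall i, (i \in loc f X) ==> (i \in loc f Y)].
  apply: contra xX => /forallP h; rewrite (lattice_loc LX).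
  rewrite memvE; apply/subv_bigcapP => i iX; rewrite -memvE.
  by have := h i; rewrite iX /= mem_loc => /subvP/(_ x xY).
by move=> /forallPn[i]; rewrite negb_imply => /andP[iX iY]; exists i.
Qed.

(** * Faces and points *)

Lemma perturb (J : finType) (a b : J -> R) :
  exists2 e0 : R, 0 < e0 & forall e, 0 < e <= e0 -> forall j,
    sign_of (a j + e * b j) = if a j == 0 then sign_of (b j) else sign_of (a j).
Proof.
pose c j : R := `|a j| / (`|b j| + 1).
have c_gt0 j : a j != 0 -> 0 < c j.
  by move=> aj; rewrite divr_gt0 ?normr_gt0 // ltr_wpDl.
pose e0 : R := \big[Order.min/1]_(j | a j != 0) c j.
have e0_gt0 : 0 < e0 by apply: lt_bigmin => // j; apply: c_gt0.
exists e0 => // e /andP[e_gt0 ee0] j.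
have [->|aj] := eqVneq (a j) 0.
  rewrite add0r /sign_of mulf_eq0 gt_eqF //= pmulr_rgt0 //.
have eb : `|e * b j| < `|a j|.
  rewrite normrM gtr0_norm //.
  have : e <= c j by apply: le_trans ee0 _; apply: bigmin_le_cond.
  rewrite /c ler_pdivlMr ?ltr_wpDl // mulrDr mulr1 => /(lt_le_trans _); apply.
  by rewrite ltrDl.
move: (a j) (e * b j) aj eb => u v u0 uv.
have uv0 : u + v != 0.
  by apply: contraTneq uv => /eqP; rewrite addr_eq0 => /eqP->; rewrite normrN ltxx.
rewrite /sign_of (negPf u0) (negPf uv0); congr (if _ then _ else _).
have [u_gt0|u_le0] := ltP 0 u.
  move: uv; rewrite (gtr0_norm u_gt0) ltr_norml => /andP[uv _].
  by rewrite -ltrBlDl sub0r.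
move: uv; rewrite (ler0_norm u_le0) ltr_norml => /andP[_ uv].
by apply/negbTE; rewrite -leNgt -lerBrDl sub0r ltW.
Qed.

(** Geometrically, the product [F G] is the face entered when moving from a point
    of [F] a little in the direction of a point of [G]. *)
Lemma points_mul F G x y : points F x -> points G y ->
  exists2 e0 : R, 0 < e0 & forall e, 0 < e <= e0 -> points (fmul F G) (x + e *: y).
Proof.
move=> Fx Gy; have [e0 e00 h] := perturb (fun i => f i x : R) (fun i => f i y : R).
exists e0 => // e /h he; apply/ffunP => i; have := he i.
rewrite -/(sgn _ i) sgnM ffunE (sgn_pt i Fx) (sgn_pt i Gy) sign_of_eq0 => <-.
by rewrite linearD linearZ.
Qed.

End Faces.

(** * The order of the faces *)

Section FaceOrder.
Variables (R : realType) (l : nat) (I : finType).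
Local Notation W := 'rV[R]_l.
Local Notation Wdual := 'Hom('rV[R]_l, R^o).
Variable f : I -> Wdual.
Local Notation face := (face f).
Local Notation hyp := (hyp f).
Implicit Types (F G C D E : face) (X Y Z : {vspace W}).

Lemma sign_of_near (u v : R) : `|v - u| < `|v| -> sign_of u = sign_of v.
Proof.
have [v_gt0|v_le0] := ltP 0 v.
  rewrite (gtr0_norm v_gt0) ltr_norml => /andP[_ uv].
  have u_gt0 : 0 < u by lra.
  by rewrite /sign_of !gt_eqF // v_gt0 u_gt0.
rewrite (ler0_norm v_le0) ltr_norml => /andP[uv uv'].
have u_lt0 : u < 0 by lra.
have v_lt0 : v < 0 by lra.
by rewrite /sign_of !lt_eqF // !ltNge !ltW.
Qed.

(** The forms are continuous: the bound on [x - y] makes the form move by less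
    than its value at [y]. *)
Lemma nbhs_sign (i : I) (y : W) : (f i y : R) != 0 ->
  nbhs y [set x | sign_of (f i x : R) = sign_of (f i y : R)]%classic.
Proof.
move=> fy0; pose s : R := 1 + \sum_j `|f i (delta_mx 0 j) : R|.
have s_gt0 : 0 < s by rewrite ltr_pwDl // sumr_ge0.
apply/nbhs_ballP; exists (`|f i y : R| / s); first by rewrite /= divr_gt0 ?normr_gt0.
move=> x /= [_ yx].
have : `|f i (y - x) : R| < `|f i y : R|.
  rewrite [y - x]row_sum_delta linear_sum /=.
  apply: le_lt_trans (ler_norm_sum _ _ _) _.
  apply: (@le_lt_trans _ _ (\sum_j (`|f i y : R| / s) * `|f i (delta_mx 0 j) : R|)).
    apply: ler_sum => j _; rewrite linearZ normrM ler_wpM2r //.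
    by have := yx 0 j; rewrite /ball /= !mxE => /ltW.
  rewrite -mulr_sumr -mulrA gtr_pMr ?normr_gt0 // mulrC ltr_pdivrMr // mul1r.
  by rewrite /s ltrDr.
by rewrite linearB /=; apply: sign_of_near.
Qed.

(** The topological order is the one of sign vectors: [G] is in the closure of
    [F] when [F] agrees with [G] wherever [G] has a sign, because then the small
    steps from [G] towards [F] end in [F]. *)
Lemma fleP F G : fle F G = (fmul G F == F).
Proof.
apply/asboolP/eqP => [FG|GF].
  apply: face_eqP => i; rewrite sgnM; case: eqP => // /eqP Gi.
  have fG : (f i (pt G) : R) != 0.
    by rewrite -sign_of_eq0 -(sgn_pt i (ptP G)).
  have [x [Fx /= xy]] := FG _ (ptP G) _ (nbhs_sign fG).
  by rewrite (sgn_pt i (ptP G)) (sgn_pt i Fx).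
move=> y Gy B /nbhs_ballP[e /= e0 yB].
have [e1 e1_gt0 h] := points_mul Gy (ptP F).
pose x := pt F; pose s : R := 1 + \sum_j `|x 0 j|.
have s_gt0 : 0 < s by rewrite ltr_pwDl // sumr_ge0.
pose e2 := Order.min e1 (e / s).
have e2_gt0 : 0 < e2 by rewrite lt_min e1_gt0 divr_gt0.
exists (y + e2 *: x); split.
  by rewrite -GF; apply: h; rewrite e2_gt0 ge_min lexx.
apply: yB; split=> // i j; rewrite ord1 /ball /= !mxE opprD addNKr normrN.
rewrite normrM gtr0_norm //.
apply: (@le_lt_trans _ _ (e / s * `|x 0 j|)).
  by rewrite ler_wpM2r // ge_min lexx orbT.
rewrite -mulrA gtr_pMr // mulrC ltr_pdivrMr // mul1r /s.
rewrite (bigD1 j) //= addrCA ltrDl ltr_pwDl //.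
by rewrite sumr_ge0.
Qed.

End FaceOrder.

(** * Orientations *)

Section Orientations.
Variables (R : realType) (l : nat).
Local Notation Wdual := 'Hom('rV[R]_l, R^o).
Implicit Types (U : {vspace Wdual}) (pos : pred (seq Wdual)).

Let coordmx n (c d : n.-tuple Wdual) : 'M[R]_n :=
  \matrix_(i, j) coord c i (tnth d j).

Lemma orientE U pos n (c d : n.-tuple Wdual) :
  is_orientation U pos -> basis_of U c -> basis_of U d ->
  pos d = if 0 < \det (coordmx c d) then pos c else ~~ pos c.
Proof.
move=> oU bc bd; have nU : n = \dim U by rewrite (vector.size_basis bc).
by move: c d bc bd; rewrite nU; apply: oU.
Qed.

Lemma coordmx_det_neq0 U n (c d : n.-tuple Wdual) :
  basis_of U c -> basis_of U d -> \det (coordmx c d) != 0.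
Proof.
move=> bc bd.
suff /(congr1 determinant) : coordmx c d *m coordmx d c = 1%:M.
  rewrite det_mulmx det1 => M1; apply: contra_eq_neq M1 => ->.
  by rewrite mul0r eq_sym oner_eq0.
apply/matrixP => i j; rewrite !mxE.
transitivity (coord c i (tnth c j)); last first.
  by rewrite (tnth_nth 0) coord_free ?(basis_free bc) // eq_sym.
have -> : tnth c j = \sum_k coord d k (tnth c j) *: d`_k.
  apply: (coord_basis bd); by apply: (basis_mem bc); apply: mem_tnth.
rewrite linear_sum; apply: eq_bigr => k _.
by rewrite !mxE linearZ /= (tnth_nth 0) mulrC.
Qed.

(** The matrix from [v :: c] to [v2 :: d] is block triangular, with corner [a] and
    with the matrix from [c] to [d] as its other diagonal block. *)
Lemma orient_cons U U' pos pos' (c d : seq Wdual) (v v2 : Wdual) (a : R) :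
  is_orientation U pos -> is_orientation U' pos' ->
  basis_of U' c -> basis_of U' d -> basis_of U (v :: c) ->
  basis_of U (v2 :: d) -> v2 - a *: v \in U' -> a != 0 ->
  (pos' d == pos (v2 :: d)) = (if 0 < a then id else negb) (pos' c == pos (v :: c)).
Proof.
move=> oU oU' bc bd bvc bvd v2U a0.
have sc : size d == size c 
  by rewrite -(vector.size_basis (X := in_tuple c) bc)
    -(vector.size_basis (X := in_tuple d) bd).
pose tc := in_tuple c; pose td := Tuple sc.
have bc' : basis_of U' tc by [].
have bd' : basis_of U' td by [].
have bvc' : basis_of U [tuple of v :: tc] by [].
have bvd' : basis_of U [tuple of v2 :: td] by [].
have := orientE oU bvc' bvd'; rewrite [pos [tuple of v2 :: _]]/= => ->.
have := orientE oU' bc' bd'; rewrite [pos' td]/= => ->.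
rewrite [pos [tuple of v :: _]]/= [pos' tc]/=.
set M := coordmx [tuple of v :: tc] _; set M' := coordmx tc td.
have M'0 : \det M' != 0 := coordmx_det_neq0 bc' bd'.
have fr : free [tuple of v :: tc] := basis_free bvc'.
have -> : \det M = a * \det M'.
  have cE (k : R) (u : Wdual) (i : 'I_(size c).+1) : u - k *: v \in U' ->
    coord [tuple of v :: tc] i u =
    if unlift ord0 i is Some j then coord tc j (u - k *: v) else k.
    move=> uU; set r := RHS.
    pose rr (i : 'I_(size c).+1) : R :=
      if unlift ord0 i is Some j then coord tc j (u - k *: v) else k.
    rewrite {1}(_ : u = \sum_i rr i *: [tuple of v :: tc]`_i).
      by rewrite (coord_sum_free _ _ fr).
    rewrite big_ord_recl /= /rr unlift_none -[LHS](subrK (k *: v)) addrC; congr (_ + _).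
    rewrite [LHS](coord_basis bc' uU); apply: eq_bigr => j _.
    by rewrite liftK.
  rewrite (expand_det_row _ ord0) big_ord_recl big1 ?addr0 => [|j _]; last first.
    rewrite !mxE (cE 0) ?unlift_none ?mul0r //.
    by rewrite scale0r subr0 tnthS; apply: (basis_mem bd'); apply: mem_tnth.
  rewrite !mxE (cE a) ?unlift_none //; congr (_ * _).
  rewrite /cofactor expr0 mul1r; congr (\det _); apply/matrixP => i j.
  rewrite !mxE (cE 0) ?liftK tnthS scale0r subr0 //.
  by apply: (basis_mem bd'); apply: mem_tnth.
have [a_gt0|a_le0] := ltP 0 a.
  by rewrite pmulr_rgt0 //; case: ifP => // _; case: (pos _); case: (pos' _).
have a_lt0 : a < 0 by rewrite lt_neqAle a0.
rewrite nmulr_rgt0 //; case: (ltgtP (\det M') 0) M'0 => // _ _.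
  by case: (pos _); case: (pos' _).
by case: (pos _); case: (pos' _).
Qed.

Lemma orient_swap U pos (c : seq Wdual) (u v : Wdual) :
  is_orientation U pos -> basis_of U [:: u, v & c] -> basis_of U [:: v, u & c] ->
  pos [:: u, v & c] = ~~ pos [:: v, u & c].
Proof.
move=> oU buv bvu.
pose tc := in_tuple c.
have buv' : basis_of U [tuple of u :: [tuple of v :: tc]] by [].
have bvu' : basis_of U [tuple of v :: [tuple of u :: tc]] by [].
have := orientE oU bvu' buv'; rewrite [pos [tuple of u :: _]]/= => ->.
set M := coordmx _ _.
suff -> : \det M = -1 by rewrite ltr0N1.
have fr := basis_free bvu'.
pose s : 'S_(size c).+2 := tperm ord0 (lift ord0 ord0).
have -> : M = perm_mx s.
  apply/matrixP => i j; rewrite !mxE.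
  have -> : tnth [tuple of u :: [tuple of v :: tc]] j =
            [tuple of v :: [tuple of u :: tc]]`_(s j).
    rewrite (tnth_nth 0) /s.
    case: tpermP => [->|->|/eqP j0 /eqP j1] //.
    by case: j j0 j1 => -[|[|j]].
  rewrite coord_free // -[s j == i](inj_eq (@perm_inj _ s)) tpermK.
  by rewrite eq_sym.
by rewrite det_perm odd_tperm.
Qed.

End Orientations.

(** * Boundary signs *)

Section BoundarySigns.
Variables (R : realType) (l : nat) (I : finType).
Local Notation W := 'rV[R]_l.
Local Notation Wdual := 'Hom('rV[R]_l, R^o).
Variable f : I -> Wdual.
Local Notation face := (face f).
Local Notation hyp := (hyp f).
Variable o : {vspace W} -> pred (seq Wdual).
Hypothesis fo : orients f o.
Implicit Types (F G C D E : face) (X Y Z : {vspace W}) (u v g : Wdual) (x : W).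

Lemma ann_sub X Y : (X <= Y)%VS -> (ann Y <= ann X)%VS.
Proof.
by move=> XY; apply/subvP => g; rewrite !mem_ann; apply: subv_trans.
Qed.

Lemma ann_eval0 X v x : v \in ann X -> x \in X -> (v x : R) = 0.
Proof. by rewrite mem_ann => /subvP h /h; rewrite memv_ker => /eqP. Qed.

(** The annihilator of [Y] has codimension one in the one of [X], and [v] spans a
    complement. *)
Lemma ann_reduce X Y v g x : cover X Y -> v \in ann X -> x \in Y ->
  (v x : R) != 0 -> g \in ann X -> g - ((g x : R) / (v x : R)) *: v \in ann Y.
Proof.
move=> XY vX xY vx gX; rewrite mem_ann.
have xX : x \notin X by apply: contra vx => xX; apply/eqP/(ann_eval0 vX).
apply: (cover_in XY _ xY xX).
  by rewrite -mem_ann rpredB // rpredZ.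
by rewrite add_lfunE opp_lfunE scale_lfunE /= [_ *: _]divfK // subrr.
Qed.

Lemma ann_basis X Y v (c : seq Wdual) x : cover X Y -> v \in ann X -> x \in Y ->
  (v x : R) != 0 -> basis_of (ann Y) c -> basis_of (ann X) (v :: c).
Proof.
move=> XY vX xY vx /andP[/eqP sc fc].
rewrite /basis_of free_cons fc span_cons sc andbT.
have -> : (v \notin ann Y).
  by apply: contra vx => vY; apply/eqP/(ann_eval0 vY).
rewrite andbT eqEsubv subv_add -memvE vX ann_sub ?coverS //=.
apply/subvP => g gX; rewrite -(subrK (((g x : R) / (v x : R)) *: v) g) addrC.
by apply: memv_add; [rewrite rpredZ ?memv_line | apply: ann_reduce gX].
Qed.

Lemma sign_val_sign_of (a : R) : sign_val R (sign_of a) * a = `|a|.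
Proof.
rewrite /sign_of; case: (ltgtP a 0) => [a0|a0|->] /=; last by rewrite mul0r normr0.
  by rewrite mulN1r ltr0_norm.
by rewrite mul1r gtr0_norm.
Qed.

Lemma points_notin F E x : cover (supp E) (supp F) -> points F x ->
  x \notin supp E.
Proof.
move=> EF Fx; have [i iE iF] := cover_loc (supp_lattice E) EF.
apply: contra iF => xE; rewrite -sgn_eq0 (sgn_pt i Fx) sign_of_eq0.
by rewrite mem_loc in iE; have := subvP iE x xE; rewrite memv_ker.
Qed.

Lemma outwardP F E v x : cover (supp E) (supp F) -> fmul E F = F ->
  points F x -> outward F E v -> v \in ann (supp E) /\ 0 < (v x : R).
Proof.
move=> EF EFF Fx [[_ [_ [[_ [c [cb ->]] ->] [_ [d [db ->]] ->] vE]]] vN].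
have {vE} vE y : (v y : R) =
    \sum_i (sign_val R (sgn F i) - sign_val R (sgn E i)) * (f i y : R)
    + (\sum_(i in loc f (supp F)) c i * (f i y : R)
    - \sum_(i in loc f (supp E)) d i * (f i y : R)).
  rewrite vE !(add_lfunE, opp_lfunE, sum_lfunE).
  under eq_bigr do rewrite scale_lfunE.
  under [\sum_(i in _) (_ : Wdual) _]eq_bigr do rewrite scale_lfunE.
  under [X in _ - (X + _)]eq_bigr do rewrite scale_lfunE.
  under [X in _ - (_ + X)]eq_bigr do rewrite scale_lfunE.
  under [in RHS]eq_bigr do rewrite mulrBl.
  rewrite sumrB opprD addrACA; congr (_ + _).
(* Only the hyperplanes through [E] contribute to the difference. *)
have off i : sgn E i != Zero -> sgn F i = sgn E i.
  by move=> Ei; rewrite -EFF sgnM (negPf Ei).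
have vEE : v \in ann (supp E).
  rewrite mem_ann; apply/subvP => y yE; rewrite memv_ker vE; apply/eqP.
  have y0 i : i \in loc f (supp E) -> (f i y : R) = 0.
    by rewrite mem_loc => /subvP/(_ y yE); rewrite memv_ker => /eqP.
  rewrite [X in X + _]big1 => [|i _]; last first.
    have [Ei|/off->] := eqVneq (sgn E i) Zero; last by rewrite subrr mul0r.
    by rewrite y0 ?mulr0 // -sgn_eq0 Ei.
  rewrite [X in _ + (X - _)]big1 => [|i iF]; last first.
    by rewrite y0 ?mulr0 // mem_loc (subv_trans (coverS EF)) // -mem_loc.
  by rewrite [X in _ - X]big1 ?subr0 ?addr0 // => i /y0->; rewrite mulr0.
split=> //; rewrite lt_neqAle; apply/andP; split.
  apply: contra vN; rewrite eq_sym mem_ann => /eqP vx.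
  apply: (cover_in EF _ (points_supp Fx) (points_notin EF Fx) vx).
  by rewrite -mem_ann.
rewrite vE [X in _ + (X - _)]big1 ?add0r => [|i]; last first.
  by rewrite -sgn_eq0 (sgn_pt i Fx) sign_of_eq0 => /eqP->; rewrite mulr0.
rewrite [X in _ - X]big_mkcond -sumrB; apply: sumr_ge0 => i _ /=.
case: ifPn; rewrite -sgn_eq0 => Ei; last by rewrite off // subrr mul0r subr0.
rewrite (eqP Ei) subr0 {1}(sgn_pt i Fx) sign_val_sign_of subr_ge0.
by apply: le_trans (ler_norm _) _; rewrite normrM ler_piMl // ler_norml.
Qed.

Lemma outward_ex F E : cover (supp E) (supp F) -> fmul E F = F ->
  exists v, outward F E v.
Proof.
move=> EF EFF; have [i iE iF] := cover_loc (supp_lattice E) EF.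
have z0 (S : {set I}) : zonotope f S 0.
  exists (fun=> 0); split=> [j|]; first by rewrite lerN10 ler01.
  by rewrite big1 // => j _; rewrite scale0r.
pose v : Wdual := \sum_j sign_val R (sgn F j) *: f j
                  - \sum_j sign_val R (sgn E j) *: f j.
exists v; split.
  exists (\sum_j sign_val R (sgn F j) *: f j),
         (\sum_j sign_val R (sgn E j) *: f j); split=> //.
  - by exists 0; rewrite ?addr0.
  - by exists 0; rewrite ?addr0.
rewrite mem_ann; apply/subvPn; exists (pt F); first exact/points_supp/ptP.
rewrite memv_ker; apply: lt0r_neq0.
rewrite /v -sumrB sum_lfunE (bigD1 i) //= ltr_pwDl //.
  rewrite -scalerBl scale_lfunE.
  rewrite -sgn_eq0 in iE; rewrite (eqP iE) subr0 {1}(sgn_pt i (ptP F)).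
  by rewrite [_ *: _]sign_val_sign_of normr_gt0 -sign_of_eq0 -(sgn_pt i (ptP F)) sgn_eq0.
apply: sumr_ge0 => j _; rewrite -scalerBl scale_lfunE [_ *: _]mulrBl.
have [->|Ej] := eqVneq (sgn E j) Zero; rewrite /=.
  by rewrite mul0r subr0 {1}(sgn_pt j (ptP F)) sign_val_sign_of normr_ge0.
by rewrite -{1}EFF sgnM (negPf Ej) subrr.
Qed.

(** An outward vector of the facet vanishes on the smaller face and is positive
    on the larger one, and the bases obtained from two such forms differ by a
    triangular matrix with a positive corner: hence the boundary sign can be
    read off any form of this kind, and does not depend on the choices. *)
Lemma agreeP F E v (c : seq Wdual) x : cover (supp E) (supp F) -> fmul E F = F ->
  v \in ann (supp E) -> points F x -> 0 < (v x : R) ->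
  basis_of (ann (supp F)) c ->
  agree o F E = (o (supp F) c == o (supp E) (v :: c)).
Proof.
move=> EF EFF vE Fx vx bc.
have cmp v' c' : outward F E v' -> basis_of (ann (supp F)) c' ->
    (o (supp F) c' == o (supp E) (v' :: c')) =
    (o (supp F) c == o (supp E) (v :: c)).
  move=> /(outwardP EF EFF Fx)[v'E v'x] bc'.
  have xF := points_supp Fx.
  have a_gt0 : 0 < (v' x : R) / (v x : R) by rewrite divr_gt0.
  rewrite (orient_cons (fo (supp_lattice E)) (fo (supp_lattice F)) bc bc'
    (v := v) (v2 := v') (a := (v' x : R) / (v x : R))) ?a_gt0 //.
  - by apply: (ann_basis EF vE xF _ bc); rewrite gt_eqF.
  - by apply: (ann_basis EF v'E xF _ bc'); rewrite gt_eqF.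
  - by apply: (ann_reduce EF vE xF) => //; rewrite gt_eqF.
  - by rewrite gt_eqF.
apply/asboolP/eqP => [[v' [c' [ov' bc' /eqP]]]|]; first by rewrite cmp // => /eqP.
have [v' ov'] := outward_ex EF EFF.
by move=> /eqP; rewrite -(cmp _ _ ov' bc) => /eqP oo; exists v', c.
Qed.

Lemma ann_basis_ex X : {c : seq Wdual | basis_of (ann X) c}.
Proof. by exists (vbasis (ann X)); apply: vbasisP. Qed.

Lemma ann_pos_ex X Y x : X \in lattice f [set: I] -> cover X Y -> x \in Y ->
  x \notin X -> exists2 v, v \in ann X & 0 < (v x : R).
Proof.
move=> LX XY xY xX.
have [i iX fx] : exists2 i, i \in loc f X & (f i x : R) != 0.
  have : ~~ [forall i, (i \in loc f X) ==> ((f i x : R) == 0)].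
    apply: contra xX => /forallP h; rewrite (lattice_loc LX) memvE.
    apply/subv_bigcapP => i iX; rewrite -memvE memv_ker.
    by have := h i; rewrite iX.
  by move=> /forallPn[i]; rewrite negb_imply => /andP[iX ?]; exists i.
have iA : f i \in ann X by rewrite mem_ann -mem_loc.
have [fx_gt0|fx_le0] := ltP 0 (f i x : R); first by exists (f i).
exists (- f i); first by rewrite rpredN.
by rewrite opp_lfunE /= oppr_gt0 lt_neqAle fx.
Qed.

Lemma points_opp G x : points G x -> points (fopp G) (- x).
Proof.
move=> Gx; apply/ffunP => i; rewrite ffunE -/(sgn _ i) sgn_opp (sgn_pt i Gx).
rewrite linearN /sign_of oppr_eq0 oppr_gt0.
by case: (ltgtP (f i x : R) 0).
Qed.

(** On [supp G] the forms that vanish on [C] are proportional, so that a face next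
    to [C] is determined by a single sign. *)
Lemma cover_faces C G F : cover (supp C) (supp G) -> supp F = supp G ->
  fmul C F = F -> F = fmul C G \/ F = fmul C (fopp G).
Proof.
move=> CG FG CF; have xG := ptP G; have xF := ptP F.
have CF' : cover (supp C) (supp F) by rewrite FG.
have [v vC vG] := ann_pos_ex (supp_lattice C) CG (points_supp xG)
                    (points_notin CG xG).
have prop i : i \in loc f (supp C) -> (f i (pt F) : R) =
    (f i (pt G) : R) / (v (pt G) : R) * (v (pt F) : R).
  rewrite mem_loc -mem_ann => iA.
  have := ann_reduce CG vC (points_supp xG) (lt0r_neq0 vG) iA.
  rewrite -FG => /ann_eval0/(_ (points_supp xF)).
  by rewrite add_lfunE opp_lfunE scale_lfunE => /eqP; rewrite subr_eq0 => /eqP.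
have vF : (v (pt F) : R) != 0.
  apply: contra (points_notin CF' xF) => /eqP vF.
  rewrite (lattice_loc (supp_lattice C)) memvE.
  apply/subv_bigcapP => i /prop; rewrite vF mulr0 -memvE memv_ker => ->.
  by rewrite eqxx.
have off i : sgn C i != Zero -> sgn F i = sgn C i.
  by move=> Ci; rewrite -CF sgnM (negPf Ci).
have [vF_gt0|vF_le0] := ltP 0 (v (pt F) : R); [left|right]; apply: face_eqP => i.
  rewrite sgnM; case: ifPn => [|/off //]; rewrite sgn_eq0 => /prop e.
  rewrite (sgn_pt i xF) (sgn_pt i xG) e.
  have k_gt0 : 0 < (v (pt F) : R) / (v (pt G) : R) by rewrite divr_gt0.
  rewrite mulrAC -mulrA /sign_of mulf_eq0 (gt_eqF k_gt0) orbF.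
  by rewrite pmulr_lgt0.
rewrite sgnM; case: ifPn => [|/off //]; rewrite sgn_eq0 => /prop e.
rewrite sgn_opp (sgn_pt i xF) (sgn_pt i xG) e.
have k_lt0 : (v (pt F) : R) / (v (pt G) : R) < 0.
  by rewrite ltr_pdivrMr // mul0r lt_neqAle vF.
rewrite mulrAC -mulrA /sign_of mulf_eq0 (lt_eqF k_lt0) orbF.
rewrite nmulr_lgt0 //.
by case: (ltgtP (f i (pt G) : R) 0).
Qed.

Lemma cover_faces_neq C G : cover (supp C) (supp G) ->
  fmul C G != fmul C (fopp G).
Proof.
move=> CG; have [i iC iG] := cover_loc (supp_lattice C) CG.
rewrite -!sgn_eq0 in iC iG; apply/eqP => /(congr1 (fun F => sgn F i)).
rewrite !sgnM iC sgn_opp; by case: (sgn G i) iG.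
Qed.

Lemma agree_mul C G v (c : seq Wdual) : cover (supp C) (supp G) ->
  v \in ann (supp C) -> 0 < (v (pt G) : R) -> basis_of (ann (supp G)) c ->
  agree o (fmul C G) C = (o (supp G) c == o (supp C) (v :: c)).
Proof.
move=> CG vC vG bc; have sG := supp_mul (coverS CG).
have [e e_gt0 eP] := points_mul (ptP C) (ptP G).
rewrite -sG in bc CG |- *; apply: (agreeP CG _ vC (eP e _)) => //.
- by rewrite fmulA fmulid.
- by rewrite e_gt0 lexx.
rewrite linearD linearZ /= (ann_eval0 vC (points_supp (ptP C))) add0r.
exact: (mulr_gt0 e_gt0 vG).
Qed.

(** The test form does not depend on [C], because [C G] and [C' G] both lie on the
    side of [G]. *)
Lemma agree_indep C C' G : supp C = supp C' -> cover (supp C) (supp G) ->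
  agree o (fmul C G) C = agree o (fmul C' G) C'.
Proof.
move=> CC CG; have [v vC vG] := ann_pos_ex (supp_lattice C) CG
  (points_supp (ptP G)) (points_notin CG (ptP G)).
have [c bc] := ann_basis_ex (supp G).
by rewrite !(agree_mul _ _ vG bc) -?CC.
Qed.

Lemma agree_opp C G : cover (supp C) (supp G) ->
  agree o (fmul C (fopp G)) C = ~~ agree o (fmul C G) C.
Proof.
move=> CG; have xG := points_supp (ptP G).
have [v vC vG] := ann_pos_ex (supp_lattice C) CG xG (points_notin CG (ptP G)).
have [c bc] := ann_basis_ex (supp G).
rewrite (agree_mul CG vC vG bc).
have sG := supp_mul (coverS CG).
have sG' : supp (fmul C (fopp G)) = supp G by rewrite supp_mul supp_opp ?coverS.
have [e e_gt0 eP] := points_mul (ptP C) (points_opp (ptP G)).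
have vC' : - v \in ann (supp C) by rewrite rpredN.
rewrite -sG' in bc CG |- *.
rewrite (agreeP CG _ vC' (eP e _) _ bc) ?e_gt0 ?lexx ?fmulA ?fmulid //; last first.
  rewrite opp_lfunE linearD linearZ linearN /=.
  rewrite (ann_eval0 vC (points_supp (ptP C))) add0r scalerN opprK.
  exact: (mulr_gt0 e_gt0 vG).
rewrite sG' in bc CG *.
rewrite (orient_cons (fo (supp_lattice C)) (fo (supp_lattice G)) bc bc
  (v := v) (v2 := - v) (a := -1)) ?ltr0N1 //.
- by apply: (ann_basis CG vC xG _ bc); rewrite gt_eqF.
- by apply: (ann_basis CG vC' xG _ bc); rewrite opp_lfunE oppr_eq0 gt_eqF.
- by rewrite scaleN1r opprK addNr rpred0.
- by rewrite oppr_eq0 oner_eq0.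
Qed.

End BoundarySigns.

(** * The diamond property *)

Section Diamond.
Variables (R : realType) (l : nat) (I : finType).
Local Notation W := 'rV[R]_l.
Local Notation Wdual := 'Hom('rV[R]_l, R^o).
Variable f : I -> Wdual.
Local Notation face := (face f).
Local Notation hyp := (hyp f).
Variable o : {vspace W} -> pred (seq Wdual).
Hypothesis fo : orients f o.
Variables (E G : face).
Hypotheses (EG : fmul E G = G) (dEG : \dim (supp G) = (\dim (supp E)).+2).
Implicit Types (F : face) (u v g : Wdual) (x : W).

(** Oriented so as to be nonnegative on [G]; this is zero when the [k]-th
    hyperplane contains [G]. *)
Let hat k : Wdual := sign_val R (sgn G k) *: f k.

Let hatE k x : (hat k x : R) = sign_val R (sgn G k) * (f k x : R).
Proof. by rewrite /hat scale_lfunE. Qed.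

Let hat_ge0 F k : fmul F G = G -> 0 <= (hat k (pt F) : R).
Proof.
move=> FG; rewrite hatE -{1}FG sgnM (sgn_pt k (ptP F)) sign_of_eq0.
by case: eqP => [->|_]; rewrite ?mulr0 // sign_val_sign_of.
Qed.

Let hat_gt0 k : (0 < (hat k (pt G) : R)) = (k \notin loc f (supp G)).
Proof.
rewrite hatE {1}(sgn_pt k (ptP G)) sign_val_sign_of normr_gt0 -sgn_eq0.
by rewrite (sgn_pt k (ptP G)) sign_of_eq0.
Qed.

Let hat_sign (k : I) x : k \notin loc f (supp G) ->
  sign_of (f k x : R) = if (hat k x : R) == 0 then Zero else
    if 0 < (hat k x : R) then sgn G k else sign_opp (sgn G k).
Proof.
rewrite -sgn_eq0 hatE /sign_of; case: (sgn G k) => // _ /=.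
  by rewrite mulN1r oppr_eq0 oppr_gt0; case: (ltgtP (f k x : R) 0).
by rewrite mul1r.
Qed.

Let hat_ann k : k \in loc f (supp E) -> hat k \in ann (supp E).
Proof. by rewrite mem_loc -mem_ann => kE; rewrite rpredZ. Qed.

Let EGs : (supp E <= supp G)%VS.
Proof. by rewrite -EG supp_leMl. Qed.

(** The pair [i, j] spans the cone of the forms that are nonnegative on [G]
    and vanish on [E]: its two extreme rays are the walls of [G] through [E]. *)
Let walls i j := forall k, k \in loc f (supp E) -> exists x y : R,
  [/\ 0 <= x, 0 <= y & forall z, z \in supp G ->
      (hat k z : R) = x * (hat i z : R) + y * (hat j z : R)].

Let walls_sym i j : walls i j -> walls j i.
Proof.
move=> w k /w[x [y [x0 y0 h]]]; exists y, x; split=> // z /h ->.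
by rewrite addrC.
Qed.

Let wall_face r : face := fmul E (face_of f r).

Let is_wall i j r := [/\ (i \in loc f (supp E)) && (i \notin loc f (supp G)),
  j \in loc f (supp E), r \in supp G, (hat i r : R) = 0 & 0 < (hat j r : R)].

Let between F := [&& fmul E F == F, fmul F G == G & cover (supp E) (supp F)].

Let in_E z : z \in supp G -> (forall k, k \in loc f (supp E) ->
  k \notin loc f (supp G) -> (hat k z : R) = 0) -> z \in supp E.
Proof.
move=> zG z0; rewrite (lattice_loc (supp_lattice E)) memvE.
apply/subv_bigcapP => k kE; rewrite -memvE.
have [kG|kG] := boolP (k \in loc f (supp G)).
  by move: kG; rewrite mem_loc => /subvP; apply.
have := z0 k kE kG.
rewrite hatE memv_ker => /eqP; rewrite mulf_eq0 => /orP[|//].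
rewrite -sgn_eq0 in kG.
by case: (sgn G k) kG; rewrite //= ?oner_eq0 // oppr_eq0 oner_eq0.
Qed.

(** In the plane [supp G / supp E] the forms that are positive on [G], scaled
    to be one at a point of [G], lie on an affine line; the extreme rays are
    the two extreme points. *)
Lemma walls_ex : exists i j r r', [/\ walls i j, is_wall i j r & is_wall j i r'].
Proof.
pose g := pt G.
have gG : g \in supp G := points_supp (ptP G).
pose J := [set k in loc f (supp E) | k \notin loc f (supp G)].
have J_gt0 k : k \in J -> 0 < (hat k g : R) by rewrite inE hat_gt0 => /andP[].
have JE k : k \in J -> k \in loc f (supp E) by rewrite inE => /andP[].
have inE' z : z \in supp G -> (forall k, k \in J -> (hat k z : R) = 0) ->
    z \in supp E.
  by move=> zG zJ; apply: in_E => // k kE kG; apply: zJ; rewrite inE kE.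
have [k0 k0J] : exists k, k \in J.
  apply/set0Pn; apply/negP => /eqP J0.
  suff /dimvS : (supp G <= supp E)%VS by rewrite dEG ltnNge leqnSn.
  by apply/subvP => z zG; apply: inE' => // k; rewrite J0 inE.
have gE : g \notin supp E.
  apply: contraTN (J_gt0 _ k0J) => gE; rewrite -leNgt.
  by rewrite (ann_eval0 (hat_ann (JE _ k0J)) gE).
have [d dG dE1] : exists2 d, d \in supp G & d \notin (supp E + <[g]>)%VS.
  apply/subvPn; apply/negP => /dimvS.
  rewrite dEG; apply/negP; rewrite -ltnNge.
  apply: (@leq_ltn_trans (\dim (supp E) + \dim <[g]>)); first exact: dimv_add_leqif.
  by rewrite -addn2 ltn_add2l dim_vline; case: (_ != _).
pose s k : R := (hat k d : R) / (hat k g : R).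
have hat_d k : k \in J -> (hat k d : R) = s k * (hat k g : R).
  by move=> /J_gt0 hk; rewrite /s divfK // gt_eqF.
pose i := [arg min_(k < k0 in J) s k]%O; pose j := [arg max_(k > k0 in J) s k]%O.
have [iJ imin] : i \in J /\ forall k, k \in J -> s i <= s k.
  by rewrite /i; case: arg_minP.
have [jJ jmax] : j \in J /\ forall k, k \in J -> s k <= s j.
  by rewrite /j; case: arg_maxP.
have sij : s i < s j.
  rewrite lt_neqAle imin // andbT; apply: contra dE1 => /eqP sE.
  have -> : d = (d - s i *: g) + s i *: g by rewrite subrK.
  apply: memv_add; last by rewrite rpredZ ?memv_line.
  apply: inE' => [|k kJ]; first by rewrite rpredB // rpredZ.
  have -> : s i = s k by apply/eqP; rewrite eq_le imin //= sE jmax.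
  by rewrite linearB linearZ /= [_ *: _]mulrC hat_d // mulrC subrr.
have dim1 : cover (supp E + <[g]>) (supp G).
  rewrite /cover subv_add EGs -memvE gG /= dEG eqSS.
  rewrite eqn_leq; apply/andP; split; last first.
    apply: leq_trans (dimv_add_leqif _ _) _.
    by rewrite -[(\dim (supp E)).+1]addn1 leq_add2l dim_vline; case: (_ != _).
  rewrite ltnNge; apply: contra gE => le.
  have /eqP -> : (supp E == supp E + <[g]>)%VS by rewrite eqEdim addvSl.
  by rewrite memvE addvSr.
exists i, j, (d - s i *: g), (s j *: g - d); split.
- move=> k kE; have [kG|kG] := boolP (k \in loc f (supp G)).
    exists 0, 0; split=> // z zG; rewrite !mul0r addr0 hatE.
    by rewrite mem_loc in kG; have := subvP kG z zG; rewrite memv_ker => /eqP->; rewrite mulr0.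
  have kJ : k \in J by rewrite inE kE.
  have [ki ij] := (imin k kJ, jmax k kJ).
  have sji0 : 0 < s j - s i by rewrite subr_gt0.
  pose x := (s j - s k) / (s j - s i) * ((hat k g : R) / (hat i g : R)).
  pose y := (s k - s i) / (s j - s i) * ((hat k g : R) / (hat j g : R)).
  have [gi gj gk] := And3 (J_gt0 _ iJ) (J_gt0 _ jJ) (J_gt0 _ kJ).
  exists x, y; split.
  + by rewrite mulr_ge0 ?divr_ge0 ?subr_ge0 // ltW.
  + by rewrite mulr_ge0 ?divr_ge0 ?subr_ge0 // ltW.
  pose D : Wdual := hat k - x *: hat i - y *: hat j.
  have DE z : (D z : R) = (hat k z : R) - x * (hat i z : R) - y * (hat j z : R).
    by rewrite /D !(add_lfunE, opp_lfunE, scale_lfunE).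
  have D0 z : (D z : R) = 0 ->
      (hat k z : R) = x * (hat i z : R) + y * (hat j z : R).
    by rewrite DE => /eqP; rewrite -addrA -opprD subr_eq0 => /eqP.
  suff /subvP DG : (supp G <= lker D)%VS.
    by move=> z /DG; rewrite memv_ker => /eqP/D0.
  apply: (cover_in dim1 _ dG dE1); last first.
    rewrite DE (hat_d _ iJ) (hat_d _ jJ) (hat_d _ kJ) /x /y.
    by field; rewrite !gt_eqF.
  rewrite subv_add -memvE memv_ker DE; apply/andP; split; last first.
    by apply/eqP; rewrite /x /y; field; rewrite !gt_eqF.
  rewrite -mem_ann; apply: rpredB; first apply: rpredB; first exact: hat_ann.
    by apply/rpredZ/hat_ann/JE.
  by apply/rpredZ/hat_ann/JE.
- split; rewrite ?JE -?hat_gt0 ?J_gt0 ?rpredB ?rpredZ // linearB linearZ /= ?hat_d // ?subrr //.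
  by rewrite -[_ *: _]/(_ * _) -mulrBl mulr_gt0 ?J_gt0 // subr_gt0.
- split; rewrite ?JE -?hat_gt0 ?J_gt0 ?rpredB ?rpredZ // linearB linearZ /= ?hat_d // ?subrr //.
  by rewrite -[_ *: _]/(_ * _) -mulrBl mulr_gt0 ?J_gt0 // subr_gt0.
Qed.


Let between_pt F : between F -> pt F \in supp G /\ pt F \notin supp E.
Proof.
move=> /and3P[/eqP EF /eqP FG cEF]; split; last exact: points_notin (ptP F).
by rewrite -FG; apply: (subvP (supp_leMl _ _)); apply/points_supp/ptP.
Qed.

Let hat_eq i j r k : walls i j -> is_wall i j r ->
  k \notin loc f (supp G) -> k \in loc f (supp E) ->
  0 <= (hat k r : R).
Proof.
move=> w [_ _ rG ir jr] kG /w[x [y [x0 y0 /(_ _ rG) ->]]].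
by rewrite ir mulr0 add0r mulr_ge0 // ltW.
Qed.

Let sgn_wall_face i j r k : walls i j -> is_wall i j r ->
  k \in loc f (supp E) -> k \notin loc f (supp G) ->
  sgn (wall_face r) k = if (hat k r : R) == 0 then Zero else sgn G k.
Proof.
move=> w ijr kE kG; have := hat_eq w ijr kG kE.
rewrite sgnM sgn_eq0 kE sgn_face_of (hat_sign _ kG) le0r.
by case: eqP => //= _ ->.
Qed.

Let between_wall_face i j r : walls i j -> is_wall i j r ->
  [/\ between (wall_face r), hat i \in ann (supp (wall_face r))
    & 0 < (hat j (pt (wall_face r)) : R)].
Proof.
move=> w ijr; have [/andP[iE iG] jE rG ir jr] := ijr.
have jG : j \notin loc f (supp G).
  apply: contraTN jr => jG; rewrite hatE; move: jG; rewrite mem_loc.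
  by move=> /subvP/(_ r rG); rewrite memv_ker => /eqP->; rewrite mulr0 ltxx.
have FG : fmul (wall_face r) G = G.
  apply: face_eqP => k; rewrite sgnM; case: ifPn => // Fk.
  have [kE|kE] := boolP (k \in loc f (supp E)); last first.
    by rewrite -{1}EG !sgnM sgn_eq0 (negPf kE).
  have [kG|kG] := boolP (k \in loc f (supp G)).
    move: Fk; rewrite sgnM sgn_eq0 kE sgn_face_of sign_of_eq0.
    move: kG; rewrite mem_loc => /subvP/(_ r rG).
    by rewrite memv_ker => /eqP->; rewrite eqxx.
  by move: Fk; rewrite (sgn_wall_face w ijr kE kG); case: ifP.
have sF : (supp (wall_face r) <= supp G)%VS by rewrite -FG supp_leMl.
have jF : sgn (wall_face r) j = sgn G j.
  by rewrite (sgn_wall_face w ijr jE jG) gt_eqF.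
have iF : hat i \in ann (supp (wall_face r)).
  apply: rpredZ; rewrite mem_ann -mem_loc -sgn_eq0.
  by rewrite (sgn_wall_face w ijr iE iG) ir eqxx.
have jpt : 0 < (hat j (pt (wall_face r)) : R).
  rewrite hatE -jF {1}(sgn_pt j (ptP (wall_face r))) sign_val_sign_of normr_gt0.
  rewrite -sign_of_eq0 -(sgn_pt j (ptP (wall_face r))) jF.
  by rewrite sgn_eq0.
split=> //; rewrite /between fmulA fmulid eqxx FG eqxx /=.
rewrite /cover supp_leMl /= eqn_leq; apply/andP; split.
  rewrite -ltnS -dEG ltn_neqAle dimvS // andbT.
  apply: contra (iG) => /eqP dF.
  have /eqP <- : supp (wall_face r) == supp G by rewrite eqEdim sF dF /=.
  by rewrite -sgn_eq0 (sgn_wall_face w ijr iE iG) ir eqxx.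
rewrite ltnNge; apply: contraTN jpt => dF; rewrite -leNgt.
have sE : supp E = supp (wall_face r) by apply/eqP; rewrite eqEdim supp_leMl.
by rewrite (ann_eval0 (hat_ann jE)) // sE; apply/points_supp/ptP.
Qed.

Let wall_face_uniq i j r F : walls i j -> is_wall i j r -> between F ->
  (hat i (pt F) : R) = 0 -> F = wall_face r.
Proof.
move=> w ijr bF iF; have [ptG ptE] := between_pt bF.
have /and3P[/eqP EF /eqP FG cEF] := bF.
have [/andP[iE iG] jE rG ir jr] := ijr.
have jF : 0 < (hat j (pt F) : R).
  rewrite lt_neqAle hat_ge0 // andbT; apply: contra ptE => /eqP jF.
  apply: in_E => // k /w[x [y [_ _ /(_ _ ptG) ->]]] _.
  by rewrite iF -jF !mulr0 addr0.
apply: face_eqP => k.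
have [kE|kE] := boolP (k \in loc f (supp E)); last first.
  by rewrite -{1}EF !sgnM sgn_eq0 (negPf kE).
have [kG|kG] := boolP (k \in loc f (supp G)).
  rewrite sgnM sgn_eq0 kE sgn_face_of (sgn_pt k (ptP F)).
  move: kG; rewrite mem_loc => /subvP kG.
  by have /eqP -> : f k (pt F) == 0 by [rewrite -memv_ker kG];
     have /eqP -> : f k r == 0 by rewrite -memv_ker kG.
rewrite (sgn_wall_face w ijr kE kG) (sgn_pt k (ptP F)) (hat_sign _ kG).
have [x [y [x0 y0 h]]] := w k kE.
have := hat_ge0 k FG; rewrite le0r.
rewrite !h // iF ir !mulr0 !add0r !mulf_eq0 (gt_eqF jF) (gt_eqF jr) !orbF.
by case: eqP => //= _ ->.
Qed.

Let between_wall i j F : walls i j -> i \in loc f (supp E) ->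
  j \in loc f (supp E) -> between F ->
  (hat i (pt F) : R) = 0 \/ (hat j (pt F) : R) = 0.
Proof.
move=> w iE jE bF; have [ptG ptE] := between_pt bF.
have /and3P[/eqP EF /eqP FG /andP[_ /eqP dF]] := bF.
have := hat_ge0 i FG; rewrite le0r => /predU1P[|hi]; first by left.
have := hat_ge0 j FG; rewrite le0r => /predU1P[|hj]; first by right.
suff /dimvS : (supp G <= supp F)%VS by rewrite dEG dF ltnn.
rewrite (lattice_sub (supp_lattice G) (supp_lattice F)); apply/fintype.subsetP => k kF.
apply: contraTT (kF) => kG.
have [kE|kE] := boolP (k \in loc f (supp E)); last first.
  by rewrite -sgn_eq0 -EF sgnM sgn_eq0 (negPf kE) sgn_eq0.
have [x [y [x0 y0 h]]] := w k kE.
apply/negP; rewrite -sgn_eq0 (sgn_pt k (ptP F)) sign_of_eq0 => /eqP kF0.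
have : (hat k (pt F) : R) = 0 by rewrite hatE kF0 mulr0.
have : 0 < (hat k (pt G) : R) by rewrite hat_gt0.
rewrite (h _ ptG) (h _ (points_supp (ptP G))).
move=> + /eqP; have xi := mulr_ge0 x0 (ltW hi); have yj := mulr_ge0 y0 (ltW hj).
rewrite (paddr_eq0 xi yj) !mulf_eq0 (gt_eqF hi) (gt_eqF hj) !orbF => gk /andP[/eqP x00 /eqP y00].
by move: gk; rewrite x00 y00 !mul0r addr0 ltxx.
Qed.

Let eps_wall i j r (c : seq Wdual) : walls i j -> is_wall i j r ->
  basis_of (ann (supp G)) c ->
  [/\ (agree o (wall_face r) E == agree o G (wall_face r))
      = (o (supp G) c == o (supp E) [:: hat j, hat i & c])
    & basis_of (ann (supp E)) [:: hat j, hat i & c]].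
Proof.
move=> w ijr bc; have [/andP[iE iG] jE rG ir jr] := ijr.
have [/and3P[/eqP EF /eqP FG cEF] iF jF] := between_wall_face w ijr.
have cFG : cover (supp (wall_face r)) (supp G).
  rewrite /cover -{1}FG supp_leMl dEG /=.
  by have /andP[_ /eqP->] := cEF.
have iG0 : 0 < (hat i (pt G) : R) by rewrite hat_gt0.
have bic : basis_of (ann (supp (wall_face r))) (hat i :: c).
  by apply: (ann_basis cFG iF (points_supp (ptP G)) _ bc); rewrite gt_eqF.
rewrite (agreeP fo cEF EF (hat_ann jE) (ptP _) jF bic).
rewrite (agreeP fo cFG FG iF (ptP _) iG0 bc); split.
  by case: (o (supp G) c); case: (o _ (hat i :: _)); case: (o _ _).
by apply: (ann_basis cEF (hat_ann jE) (points_supp (ptP _)) _ bic); rewrite gt_eqF.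
Qed.

(** A face between [E] and [G] lies on exactly one of the two walls. Both chains
    from [G] to [E] compare the orientation of [E] with the one of [G] extended
    by the two walls, but in the two possible orders, whence opposite signs. *)
Lemma diamond : exists F1 F2, [/\ F1 != F2,
  forall F, [&& fmul E F == F, fmul F G == G & cover (supp E) (supp F)]
            = (F == F1) || (F == F2)
  & (agree o F1 E == agree o G F1) = ~~ (agree o F2 E == agree o G F2)].
Proof.
have [i [j [r [r' [w ijr jir]]]]] := walls_ex.
have w' := walls_sym w.
exists (wall_face r), (wall_face r').
have [b1 i1 j1] := between_wall_face w ijr.
have [b2 j2 i2] := between_wall_face w' jir.
have [/andP[iE iG] jE rG ir jr] := ijr.
split.
- by apply: contraTneq j1 => ->; rewrite (ann_eval0 j2) ?ltxx //; apply/points_supp/ptP.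
- move=> F; apply/idP/orP => [bF|[/eqP->|/eqP->]] //.
  by have [/(wall_face_uniq w ijr bF)->|/(wall_face_uniq w' jir bF)->] :=
    between_wall w iE jE bF; [left|right].
have [c bc] := ann_basis_ex (supp G).
have [-> b12] := eps_wall w ijr bc; have [-> b21] := eps_wall w' jir bc.
rewrite (orient_swap (fo (supp_lattice E)) b12 b21).
by case: (o _ c); case: (o _ _).
Qed.

End Diamond.

(** * Flags and their images *)

Section FlagImages.
Variables (R : realType) (l : nat) (I : finType).
Local Notation W := 'rV[R]_l.
Local Notation Wdual := 'Hom('rV[R]_l, R^o).
Variable f : I -> Wdual.
Local Notation face := (face f).
Local Notation hyp := (hyp f).
Variable o : {vspace W} -> pred (seq Wdual).
Hypothesis fo : orients f o.
Variable K : fieldType.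
Implicit Types (F G C D E : face) (X Y Z : {vspace W}).
Implicit Types (gs : seq face) (ys : seq {vspace W}).

Local Notation supps gs := [seq supp G | G <- gs].

Definition pm1 (b : bool) : K := if b then 1 else -1.

Lemma pm1M a b : pm1 a * pm1 b = pm1 (a == b).
Proof. by case: a; case: b; rewrite /pm1 /= ?mulr1 ?mul1r ?mulN1r ?opprK. Qed.

Lemma pm1N a : pm1 (~~ a) = - pm1 a.
Proof. by case: a; rewrite /pm1 /= ?opprK. Qed.

Lemma pm12 a : pm1 a * pm1 a = 1.
Proof. by rewrite pm1M eqxx. Qed.

(** A flag that ends at [X] is stored without [X], from its largest codimension
    down; this makes it convenient to peel off terms next to [X]. *)
Fixpoint flag_below X ys : bool :=
  if ys is Y :: ys' then
    [&& Y \in lattice f [set: I], cover X Y & flag_below Y ys']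
  else X == fullv.

Section Target.
Variable M : lmodType K.
Implicit Type h : face -> M.

(** [diff_prod h C [:: G_k; ...; G_0]] is the value at [h], extended linearly, of the
    product C (G_k - -G_k) ... (G_0 - -G_0). *)
Fixpoint diff_prod h C gs : M :=
  if gs is G :: gs' then diff_prod h (fmul C G) gs' - diff_prod h (fmul C (fopp G)) gs'
  else h C.

(** The image of a flag and of a face [C] under [phi], as a sum over all the
    flags of faces that end at [C]: written in this way it involves no choice,
    and the relations between flags reduce to the diamond property. *)
Fixpoint flag_sum h C ys : M :=
  if ys is Y :: ys' then
    \sum_(F | (supp F == Y) && (fmul C F == F))
      pm1 (agree o F C) *: flag_sum h F ys'
  else h C.

Lemma diff_prod_mul h F C gs : 
  diff_prod h (fmul F C) gs = diff_prod (fun D => h (fmul F D)) C gs.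
Proof. by elim: gs C => [|G gs IH] C //=; rewrite -!fmulA !IH. Qed.

Lemma flag_sumD h h' C ys :
  flag_sum (fun D => h D + h' D) C ys = flag_sum h C ys + flag_sum h' C ys.
Proof.
elim: ys C => [|Y ys IH] C //=.
by rewrite -big_split; apply: eq_bigr => F _; rewrite IH scalerDr.
Qed.

Lemma eq_flag_sum h h' C ys : (forall D, fmul C D = D -> h D = h' D) ->
  flag_sum h C ys = flag_sum h' C ys.
Proof.
elim: ys C => [|Y ys IH] C hh /=; first by rewrite hh ?fmulid.
apply: eq_bigr => F /andP[_ /eqP CF]; congr (_ *: _); apply: IH => D FD.
by apply: hh; rewrite -FD fmulA CF.
Qed.

Lemma flag_sum0 C ys : flag_sum (fun=> 0) C ys = 0.
Proof.
by elim: ys C => [|Y ys IH] C //=; rewrite big1 // => F _; rewrite IH scaler0.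
Qed.

(** The two faces of the sum are on the two sides of [C], with opposite signs. *)
Lemma flag_sum_cons h C G ys : cover (supp C) (supp G) ->
  flag_sum h C (supp G :: ys) = pm1 (agree o (fmul C G) C) *:
    (flag_sum h (fmul C G) ys - flag_sum h (fmul C (fopp G)) ys).
Proof.
move=> CG /=; rewrite (bigD1 (fmul C G)) /=; last first.
  by rewrite supp_mul ?coverS // fmulA fmulid !eqxx.
rewrite (big_pred1 (fmul C (fopp G))) /= => [|F]; last first.
  apply/andP/eqP => [[/andP[/eqP FG /eqP CF] FN]|->].
    by have [FE|//] := cover_faces CG FG CF; rewrite FE eqxx in FN.
  rewrite supp_mul ?supp_opp ?coverS // fmulA fmulid !eqxx; split=> //.
  by rewrite eq_sym cover_faces_neq.
by rewrite (agree_opp fo CG) pm1N scaleNr scalerBr.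
Qed.

End Target.

Fixpoint flag_sign C gs : K :=
  if gs is G :: gs' then pm1 (agree o (fmul C G) C) * flag_sign (fmul C G) gs'
  else 1.

Lemma flag_below_supp X G gs : flag_below X (supps (G :: gs)) ->
  cover X (supp G) /\ flag_below (supp G) (supps gs).
Proof. by move=> /= /and3P[]. Qed.

Lemma flag_sign_indep C C' gs : supp C = supp C' ->
  flag_below (supp C) (supps gs) -> flag_sign C gs = flag_sign C' gs.
Proof.
elim: gs C C' => [|G gs IH] C C' CC //= /and3P[_ CG Ggs].
rewrite (agree_indep fo CC CG); congr (_ * _).
have sG : supp (fmul C G) = supp G by rewrite supp_mul ?coverS.
by apply: IH; rewrite sG // supp_mul // -CC coverS.
Qed.

(** In each of the two terms the remaining signs are the same, since they do not
    depend on the face at the end of the flag. *)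
Lemma flag_sum_diff_prod (M : lmodType K) (h : face -> M) C gs :
  flag_below (supp C) (supps gs) ->
  flag_sum h C (supps gs) = flag_sign C gs *: diff_prod h C gs.
Proof.
elim: gs C => [|G gs IH] C; first by rewrite /= scale1r.
move=> /flag_below_supp[CG Ggs].
have sG : supp (fmul C G) = supp G by rewrite supp_mul ?coverS.
have sG' : supp (fmul C (fopp G)) = supp G by rewrite supp_mul supp_opp ?coverS.
rewrite [LHS]flag_sum_cons // !IH ?sG ?sG' //=.
rewrite (@flag_sign_indep (fmul C (fopp G)) (fmul C G)) ?sG' //.
by rewrite -scalerBr scalerA.
Qed.

(** Exchanging the sums, the faces in the middle of the chains with fixed ends
    form diamonds. *)
Lemma flag_sum_diamond (M : lmodType K) (h : face -> M) C Z ys :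
  (supp C <= Z)%VS -> \dim Z = (\dim (supp C)).+2 ->
  \sum_(F | cover (supp C) (supp F) && (fmul C F == F))
    pm1 (agree o F C) *: flag_sum h F (Z :: ys) = 0.
Proof.
move=> CZ dZ /=.
under eq_bigr do rewrite scaler_sumr.
rewrite (exchange_big_dep (fun G => (supp G == Z))) /=; last first.
  by move=> F G _ /andP[].
apply: big1 => G /eqP sG.
have [CG|CG] := eqVneq (fmul C G) G; last first.
  apply: big1 => F /andP[/andP[_ /eqP CF] /andP[_ /eqP FG]].
  by case/eqP: CG; rewrite -FG fmulA CF.
have dG : \dim (supp G) = (\dim (supp C)).+2 by rewrite sG.
have [F1 [F2 [F12 FP FS]]] := diamond fo CG dG.
have PE F : (cover (supp C) (supp F) && (fmul C F == F)) &&
    ((supp G == Z) && (fmul F G == G)) = (F == F1) || (F == F2).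
  rewrite -FP sG eqxx andTb; case: (fmul C F == F); last by rewrite andbF.
    by rewrite andbT andbC.
rewrite (eq_bigl _ _ PE) (bigD1 F1) ?eqxx //=.
rewrite (big_pred1 F2) => [|F]; last first.
  by case: (eqVneq F F1) => [->|_] /=; rewrite ?(negPf F12) ?andbT.
by rewrite !scalerA !pm1M FS pm1N scaleNr addNr.
Qed.

(** The functions on flags that factor through the module of flags; two terms
    [Y], [Z] are displayed because the smallest term of a flag is not varied. *)
Definition kills_relators (M : lmodType K) X (a : seq {vspace W} -> M) :=
  forall ys1 Z ys2,
    \sum_(Y <- undup (lattice f [set: I]) | flag_below X (ys1 ++ [:: Y, Z & ys2]))
       a (ys1 ++ [:: Y, Z & ys2]) = 0.

Lemma flag_sum_kills (M : lmodType K) (h : face -> M) C :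
  kills_relators (supp C) (flag_sum h C).
Proof.
move=> ys1 Z ys2; elim: ys1 C => [|Y1 ys1 IH] C /=; last first.
  rewrite exchange_big; apply: big1 => F /andP[/eqP sF CF] /=.
  rewrite -scaler_sumr.
  have [c|c] := boolP ((Y1 \in lattice f [set: I]) && cover (supp C) Y1).
    rewrite (eq_bigl (fun Y => flag_below (supp F) (ys1 ++ [:: Y, Z & ys2]))).
      by rewrite IH scaler0.
    by move=> Y; rewrite sF; case/andP: c => -> ->.
  by rewrite big_pred0 ?scaler0 // => Y; rewrite andbA (negPf c).
have [/and3P[CZ dZ Zys]|N] := boolP [&& (supp C <= Z)%VS,
    \dim Z == (\dim (supp C)).+2 & flag_below Z ys2 && (Z \in lattice f [set: I])];
  last first.
  rewrite big_pred0 // => Y; apply: contraNF N.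
  move=> /and5P[LY /andP[CY /eqP dY] LZ /andP[YZ /eqP dZ] ->].
  by rewrite (subv_trans CY YZ) dZ dY eqxx LZ.
rewrite -[RHS](flag_sum_diamond h ys2 CZ (eqP dZ)).
rewrite (exchange_big_dep xpredT) //= [RHS]big_mkcond; apply: eq_bigr => F _.
have [CF|CF] := eqVneq (fmul C F) F; last first.
  by rewrite andbF big_pred0 // => Y; rewrite !andbF.
rewrite andbT.
have [cF|cF] := boolP (cover (supp C) (supp F)); last first.
  rewrite big_pred0 // => Y; rewrite andbT; apply/negbTE.
  by apply: contra cF => /andP[/and3P[_ cY _] /eqP->].
have [FZ|FZ] := boolP (supp F <= Z)%VS; last first.
  rewrite big_pred0 => [|Y]; last first.
    apply/negbTE; rewrite andbT; apply: contra FZ.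
    by move=> /andP[/and4P[_ _ _ /andP[/coverS YZ _]] /eqP->].
  rewrite big_pred0 ?scaler0 // => G; apply/negbTE; apply: contra FZ.
  by move=> /andP[/eqP <- /eqP <-]; apply: supp_leMl.
rewrite (eq_bigl (pred1 (supp F))) => [|Y]; last first.
  rewrite andbT /= eq_sym; case: eqP => [->|]; rewrite ?andbF // andbT.
  rewrite supp_lattice cF; case/andP: Zys => -> ->.
  by rewrite /cover FZ (eqP dZ); case/andP: cF => _ /eqP ->; rewrite eqxx.
rewrite -big_filter filter_pred1_uniq ?undup_uniq ?mem_undup ?supp_lattice //.
by rewrite big_seq1.
Qed.

End FlagImages.

(** * Flags of subspaces as sequences *)

Section Codimension.
Variables (R : realType) (l : nat) (I : finType).
Local Notation W := 'rV[R]_l.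
Variable f : I -> 'Hom('rV[R]_l, R^o).
Implicit Types (Y Z : {vspace W}) (ys : seq {vspace W}).

Lemma dim_le_l Y : (\dim Y <= l)%N.
Proof. by apply: leq_trans (dimvS (subvf Y)) _; rewrite dimvf /dim /= mul1n. Qed.

Lemma codim_cover Y Z : (Y <= Z)%VS -> codim Y = (codim Z).+1 -> cover Y Z.
Proof.
by rewrite /cover /codim => -> ?; have := dim_le_l Y; have := dim_le_l Z; lia.
Qed.

Lemma cover_codim Y Z : cover Y Z -> codim Y = (codim Z).+1.
Proof.
by case/andP=> _; rewrite /codim; have := dim_le_l Y; have := dim_le_l Z; lia.
Qed.

Lemma codim0 Y : codim Y = 0%N -> Y = fullv.
Proof.
rewrite /codim => Y0; apply/eqP; rewrite eqEdim subvf dimvf /dim /= mul1n.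
by lia.
Qed.

Lemma codim_fullv : codim (fullv : {vspace W}) = 0%N.
Proof. by rewrite /codim dimvf /dim /= mul1n subnn. Qed.

Lemma flag_below_mem Y ys : Y \in lattice f [set: I] -> flag_below f Y ys ->
  forall Z, Z \in ys -> Z \in lattice f [set: I] /\ (Y <= Z)%VS.
Proof.
elim: ys Y => [|Y' ys IH] Y LY //= /and3P[LY' cY h] Z.
rewrite inE => /predU1P[->|/(IH _ LY' h)[LZ YZ]]; first by rewrite coverS.
by split=> //; apply: subv_trans YZ; apply: coverS.
Qed.

Lemma flag_below_codim Y ys : flag_below f Y ys -> codim Y = size ys.
Proof.
elim: ys Y => [|Y' ys IH] Y /=; first by move=> /eqP->; rewrite codim_fullv.
by move=> /and3P[_ /cover_codim-> /IH->].
Qed.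

Lemma flag_below_nth Y ys i : flag_below f Y ys -> (i <= size ys)%N ->
  codim (nth fullv (rcons (rev ys) Y) i) = i.
Proof.
elim: ys Y i => [|Y' ys IH] Y i.
  by move=> /= /eqP->; case: i => // _; rewrite codim_fullv.
move=> h; have [_ cY hY] := and3P h.
rewrite leq_eqVlt => /predU1P[->|].
  by rewrite nth_rcons size_rev /= ltnn eqxx (flag_below_codim h).
rewrite ltnS => ip; rewrite nth_rcons size_rev /= ltnS ip rev_cons.
exact: IH.
Qed.

Lemma flag_below_sorted Y ys : flag_below f Y ys ->
  sorted (@llt R l) (rcons (rev ys) Y).
Proof.
rewrite -rev_cons rev_sorted; elim: ys Y => [|Y' ys IH] Y //= /and3P[_ cY /IH].
rewrite /= => ->; rewrite andbT /llt (coverS cY) /=; apply: contraTneq cY => ->.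
by rewrite /cover (ltn_eqF (ltnSn _)) andbF.
Qed.

End Codimension.

Section FlagSequences.
Variables (R : realType) (l : nat) (I : finType).
Local Notation W := 'rV[R]_l.
Local Notation Wdual := 'Hom('rV[R]_l, R^o).
Variable f : I -> Wdual.
Variables (p : nat) (X : {vspace W}).
Hypotheses (LX : X \in lattice f [set: I]) (cX : codim X = p).
Local Notation flagX := (flag f p (loc f X)).
Implicit Types (t u : flagX) (Y Z : {vspace W}) (ys s : seq {vspace W}).

Definition flag_seq t : seq {vspace W} := [seq val U | U <- val t].
Definition flag_terms t : seq {vspace W} := rev (take p (flag_seq t)).

Lemma size_flag_seq t : size (flag_seq t) = p.+1.
Proof. by rewrite size_map size_tuple. Qed.

Lemma flag_atE t (i : 'I_p.+1) : flag_at t i = nth fullv (flag_seq t) i.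
Proof.
rewrite /flag_at /flag_seq (tnth_nth (tnth (val t) i)).
by rewrite (nth_map (tnth (val t) i)) ?size_tuple.
Qed.

Lemma flag_seq_codim t i : (i <= p)%N -> codim (nth fullv (flag_seq t) i) = i.
Proof.
move=> ip; have /andP[/forallP/(_ (Ordinal (ip : (i < p.+1)%N)))/eqP + _] := valP t.
by rewrite -/(flag_at _ _) flag_atE.
Qed.

Lemma flag_seq_in t i : (i <= p)%N ->
  nth fullv (flag_seq t) i \in lattice f (loc f X).
Proof.
by move=> ip; rewrite -(flag_atE t (Ordinal (ip : (i < p.+1)%N))); apply: valP.
Qed.

Lemma flag_seq_llt t i : (i < p)%N ->
  llt (nth fullv (flag_seq t) i) (nth fullv (flag_seq t) i.+1).
Proof.
move=> ip; have /andP[_ /(sortedP fullv) h] := valP t.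
by apply: h; rewrite size_flag_seq.
Qed.

Lemma flag_seq_last t : nth fullv (flag_seq t) p = X.
Proof.
have := flag_seq_in t (leqnn p); set Y := nth _ _ _ => LY.
have XY : (X <= Y)%VS.
  move: LY => /fintype.imageP[T]; rewrite inE => /fintype.subsetP TX ->.
  by apply/subv_bigcapP => i /TX; rewrite mem_loc.
apply/eqP; rewrite eq_sym eqEdim XY /=.
have := flag_seq_codim t (leqnn p); rewrite -/Y -cX /codim.
by have := dim_le_l X; have := dim_le_l Y; lia.
Qed.

Lemma flag_terms_below t : flag_below f X (flag_terms t).
Proof.
rewrite /flag_terms -{1}(flag_seq_last t).
suff h k : (k <= p)%N ->
    flag_below f (nth fullv (flag_seq t) k) (rev (take k (flag_seq t))).
  exact: h.
elim: k => [|k IH] kp.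
  by rewrite take0 /=; apply/eqP/codim0/flag_seq_codim.
rewrite (take_nth fullv) ?size_flag_seq 1?ltnW // rev_rcons /= IH 1?ltnW // andbT.
rewrite (latticeS (flag_seq_in t (ltnW kp))) /=.
have /andP[le _] := flag_seq_llt t kp.
by apply: codim_cover; rewrite ?flag_seq_codim // ltnW.
Qed.

Lemma size_flag_terms t : size (flag_terms t) = p.
Proof. by rewrite size_rev size_takel // size_flag_seq. Qed.

Lemma flag_seqE t : flag_seq t = rcons (rev (flag_terms t)) X.
Proof.
rewrite /flag_terms revK -[in rcons _ _](flag_seq_last t) -take_nth ?size_flag_seq //.
by rewrite take_oversize // size_flag_seq.
Qed.

Lemma flag_terms_inj : injective flag_terms.
Proof.
move=> t u tu; apply/val_inj/val_inj/(inj_map val_inj).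
by rewrite -!/(flag_seq _) !flag_seqE tu.
Qed.

Lemma map_val_seq_sub s : all (mem (lattice f (loc f X))) s ->
  exists s' : seq (seq_sub (lattice f (loc f X))), [seq val U | U <- s'] = s.
Proof.
elim: s => [|Y s IH] /=; first by exists [::].
move=> /andP[LY /IH[s' <-]].
by exists (SeqSub LY :: s').
Qed.

Lemma flag_of_ys ys : flag_below f X ys -> exists t, flag_terms t = ys.
Proof.
move=> h; pose s := rcons (rev ys) X.
have sp : size ys = p by rewrite -(flag_below_codim h).
have [s' s's] : exists s' : seq (seq_sub (lattice f (loc f X))),
    [seq val U | U <- s'] = s.
  apply: map_val_seq_sub; apply/allP => Y; rewrite mem_rcons inE mem_rev.
  move=> /predU1P[->|/(flag_below_mem LX h)[LY XY]]; exact: lattice_locS.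
have ss' : size s' == p.+1.
  by rewrite -(size_map val) s's size_rcons size_rev sp.
have F : is_flag (Tuple ss').
  rewrite /is_flag s's (flag_below_sorted h) andbT; apply/forallP => i.
  have ip : (i <= size ys)%N by rewrite sp -ltnS.
  have := flag_below_nth h ip; rewrite -/s -s's.
  rewrite (nth_map (tnth (Tuple ss') i)) ?(eqP ss') //.
  by rewrite -(tnth_nth _ (Tuple ss')) => ->.
exists (Sub (Tuple ss') F : flagX).
rewrite /flag_terms /flag_seq SubK s's /s -cats1 take_size_cat ?size_rev //.
exact: revK.
Qed.

(** The [i]-th term of a flag and its predecessor, isolated in the reversed
    sequence. *)
Lemma flag_terms_split t i : (0 < i < p)%N ->
  flag_terms t = rev (drop i.+1 (take p (flag_seq t))) ++
   [:: nth fullv (flag_seq t) i, nth fullv (flag_seq t) i.-1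
     & rev (take i.-1 (flag_seq t))].
Proof.
case: i => // i /= ip; rewrite /flag_terms; set s := flag_seq t.
have sz : size s = p.+1 := size_flag_seq t.
have h : take p s = rcons (rcons (take i s) (nth fullv s i)) (nth fullv s i.+1)
    ++ drop i.+2 (take p s).
  rewrite -!take_nth ?sz; [|lia..].
  by rewrite -{1}[take p s](cat_take_drop i.+2) take_takel.
by rewrite {1}h rev_cat !rev_rcons.
Qed.

(** A flag that agrees with [t] off [i] is determined by its [i]-th term. *)
Lemma relator_sumE (K : fieldType) (M : lmodType K) (a : seq {vspace W} -> M) t
    (i : 'I_p.+1) ys1 Y0 Z ys2 : (0 < i < p)%N -> i = (size ys2).+1 :> nat ->
  flag_terms t = ys1 ++ [:: Y0, Z & ys2] ->
  \sum_(u : flagX | [forall j, (j != i) ==> (flag_at u j == flag_at t j)])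
    a (flag_terms u) =
  \sum_(Y <- undup (lattice f [set: I]) | flag_below f X (ys1 ++ [:: Y, Z & ys2]))
    a (ys1 ++ [:: Y, Z & ys2]).
Proof.
move=> ip iE tE; pose s := flag_seq t.
have agr u : [forall j, (j != i) ==> (flag_at u j == flag_at t j)] =
    (flag_seq u == take i s ++ nth fullv (flag_seq u) i :: drop i.+1 s).
  have szu : (i < size (flag_seq u))%N by rewrite size_flag_seq; lia.
  have szt : (i < size s)%N by rewrite size_flag_seq; lia.
  apply/forallP/eqP => [h|E j].
    apply: (@eq_from_nth _ fullv).
      by rewrite size_cat /= size_drop size_takel ?size_flag_seq 1?ltnW //; lia.
    move=> j; rewrite size_flag_seq => jp.
    rewrite nth_cat size_takel; last by rewrite ltnW.
    have := h (Ordinal jp); rewrite !flag_atE /= -val_eqE /=.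
    case: ltngtP => [ji|ij|->] /= => [/eqP->|/eqP->|_].
    - by rewrite nth_take.
    - by rewrite -[(j - i)%N]prednK ?subn_gt0 //= nth_drop; congr nth; lia.
    - by rewrite subnn.
  apply/implyP; rewrite -val_eqE /= !flag_atE E nth_cat size_takel; last by rewrite ltnW.
  case: ltngtP => // [ji|ij] _; first by rewrite nth_take.
  rewrite -[(j - i)%N]prednK ?subn_gt0 //= nth_drop -/s; apply/eqP; congr nth; lia.
have [ys1E ZE ys2E] : [/\ ys1 = rev (drop i.+1 (take p s)), Z = nth fullv s i.-1
    & ys2 = rev (take i.-1 s)].
  have := flag_terms_split t ip; rewrite tE -/s => /eqP; rewrite eqseq_cat.
    by move=> /andP[/eqP-> /eqP[_ -> ->]].
  have := size_flag_terms t; rewrite tE size_cat /= size_rev size_drop size_takel.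
    by lia.
  by rewrite size_flag_seq.
have agr' u : [forall j, (j != i) ==> (flag_at u j == flag_at t j)] =
    (flag_terms u == ys1 ++ [:: nth fullv (flag_seq u) i, Z & ys2]).
  rewrite agr; set Y := nth _ _ i.
  have sE : take i s ++ Y :: drop i.+1 s =
      rcons (rev (ys1 ++ [:: Y, Z & ys2])) X.
    rewrite rev_cat !rev_cons ys2E revK ZE -take_nth ?size_flag_seq; last lia.
    rewrite prednK; last by case/andP: ip.
    rewrite cat_rcons rcons_cat; congr (_ ++ _ :: _); rewrite ys1E revK.
    rewrite -(flag_seq_last t) -/s.
    have sz : size s = p.+1 := size_flag_seq t.
    rewrite -{1}[s](@take_oversize _ p.+1) ?sz // (take_nth fullv) ?sz //.
    by rewrite drop_rcons // size_takel ?sz //; case/andP: ip.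
  rewrite sE flag_seqE; apply/eqP/eqP => [/rcons_inj[/(inv_inj revK)->]|->] //.
have -> : \sum_(u : flagX | [forall j, (j != i) ==> (flag_at u j == flag_at t j)])
    a (flag_terms u) = \sum_(ys <- [seq flag_terms u | u <- enum flagX &
      [forall j, (j != i) ==> (flag_at u j == flag_at t j)]]) a ys.
  by rewrite big_map big_filter big_enum_cond.
rewrite -[RHS]big_filter.
rewrite -[RHS](big_map (fun Y => ys1 ++ [:: Y, Z & ys2]) xpredT a).
apply/perm_big/uniq_perm.
- rewrite (map_inj_uniq flag_terms_inj). by rewrite filter_uniq ?enum_uniq.
- rewrite map_inj_uniq ?filter_uniq ?undup_uniq // => Y Y' /eqP.
  by rewrite eqseq_cat // eqxx => /eqP[].
move=> ys; apply/mapP/mapP => [[u]|[Y]].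
  rewrite mem_filter agr' => /andP[/eqP uE _] ysE.
  exists (nth fullv (flag_seq u) i); last by rewrite ysE.
  rewrite mem_filter -uE flag_terms_below mem_undup.
  by apply: (latticeS (flag_seq_in u _)); lia.
rewrite mem_filter => /andP[hY LY] ysE.
have [u uE] := flag_of_ys hY; exists u; last by rewrite uE.
rewrite mem_filter mem_enum andbT agr' uE.
suff -> : nth fullv (flag_seq u) i = Y by [].
have := flag_terms_split u ip; rewrite uE => /eqP; rewrite eqseq_cat.
  by move=> /andP[_ /eqP[]].
by rewrite ys1E !size_rev !size_drop !size_takel ?size_flag_seq.
Qed.

Lemma relator_sum (K : fieldType) (M : lmodType K) (a : seq {vspace W} -> M) t
    (i : 'I_p.+1) : kills_relators f X a -> (0 < i < p)%N ->
  \sum_(u : flagX | [forall j, (j != i) ==> (flag_at u j == flag_at t j)])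
    a (flag_terms u) = 0.
Proof.
move=> ka ip; rewrite (relator_sumE a ip _ (flag_terms_split t ip)); first exact: ka.
by rewrite size_rev size_takel ?size_flag_seq; lia.
Qed.

End FlagSequences.

(** * Free modules *)

Section FreeModules.
Variable K : fieldType.

(** [free_mod] and [gen], over an arbitrary field of coefficients. *)
Definition ffree (T : finType) : vectType K := {ffun T -> K^o}.
Definition ffree_gen (T : finType) (x : T) : ffree T := [ffun y => (y == x)%:R].

Lemma ffree_genE (T : finType) (x y : T) : ffree_gen x y = (y == x)%:R.
Proof. by rewrite ffunE. Qed.

Lemma ffree_decomp (T : finType) (a : ffree T) :
  a = \sum_x (a x : K) *: ffree_gen x.
Proof.
apply/ffunP => y; rewrite sum_ffunE (bigD1 y) //= !ffunE eqxx.
rewrite big1 => [|x /negPf xy]; first by rewrite addr0 [_ *: _]mulr1.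
by rewrite !ffunE eq_sym xy [_ *: _]mulr0.
Qed.

Lemma ffree_comb (T : finType) (M : lmodType K) (h : T -> M) x :
  \sum_y (ffree_gen x y : K) *: h y = h x.
Proof.
rewrite (bigD1 x) //= ffree_genE eqxx scale1r big1 ?addr0 // => y /negPf yx.
by rewrite ffree_genE yx scale0r.
Qed.

Definition ffree_ext (T : finType) (M : lmodType K) (h : T -> M) (a : ffree T) : M :=
  \sum_x (a x : K) *: h x.

Lemma ffree_ext_linear (T : finType) (M : lmodType K) (h : T -> M) :
  linear (ffree_ext h).
Proof.
move=> k a b; rewrite /ffree_ext scaler_sumr -big_split /=; apply: eq_bigr => x _.
by rewrite !ffunE scalerDl scalerA.
Qed.

HB.instance Definition _ (T : finType) (M : lmodType K) (h : T -> M) :=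
  GRing.isLinear.Build K (ffree T) M _ (ffree_ext h) (ffree_ext_linear h).

Lemma ffree_ext_sum (T : finType) (M : lmodType K) (h : T -> M) (P : pred T) :
  ffree_ext h (\sum_(x | P x) ffree_gen x) = \sum_(x | P x) h x.
Proof.
by rewrite linear_sum; apply: eq_bigr => x _; apply: ffree_comb.
Qed.

Lemma ffree_ext_span (T : finType) (M : lmodType K) (h : T -> M) rels a :
  (forall r, r \in rels -> ffree_ext h r = 0) -> a \in <<rels>>%VS ->
  ffree_ext h a = 0.
Proof.
move=> h0 /(coord_span (X := in_tuple rels)) ->; rewrite linear_sum big1 // => i _.
by rewrite linearZ /= h0 ?scaler0 // mem_nth.
Qed.

Definition quot_bilin (T S : finType) (M : lmodType K) (v : T -> S -> M)
    (U : {vspace ffree T}) (x : quotv U) (y : ffree S) : M :=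
  ffree_ext (fun s => ffree_ext (v^~ s) (repr x)) y.

(** Two representatives of a class differ by relations, so that the values do not
    depend on the representative chosen in the quotient. *)
Lemma quot_bilin_ex (T S : finType) (M : lmodType K) (v : T -> S -> M) rels :
  (forall r s, r \in rels -> ffree_ext (v^~ s) r = 0) ->
  exists g : {bilinear quotv <<rels>>%VS -> ffree S -> M}, forall t s,
    g (quotv_class <<rels>>%VS (ffree_gen t)) (ffree_gen s) = v t s.
Proof.
move=> v0; set U := <<rels>>%VS.
have reprE s (a : ffree T) (x : quotv U) : quotv_class U a = x ->
    ffree_ext (v^~ s) (repr x) = ffree_ext (v^~ s) a.
  move=> ax; apply/eqP; rewrite -subr_eq0 -linearB; apply/eqP.
  apply: (ffree_ext_span (rels := rels)) => [r|]; first exact: v0.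
  by rewrite -/U; apply/quotv_classP; rewrite quotv_classE.
have bil : bilinear_for *:%R *:%R (quot_bilin v (U := U)).
  split=> [y k x1 x2|x k y1 y2]; last by rewrite /quot_bilin linearP.
  rewrite /= /quot_bilin /ffree_ext scaler_sumr -big_split; apply: eq_bigr => s _ /=.
  have cls : quotv_class U (k *: repr x1 + repr x2) = k *: x1 + x2.
    rewrite quotv_classD -[x1 in RHS]quotv_classE -[x2 in RHS]quotv_classE.
    by congr (_ + _); rewrite -quotv_scale_class.
  rewrite -!/(ffree_ext _ _) (reprE s _ _ cls) linearP.
  by rewrite scalerDr !scalerA [y s * k]mulrC.
pose g : {bilinear quotv U -> ffree S -> M} := HB.pack (quot_bilin v (U := U))
  (bilinear_isBilinear.Build K (quotv U) (ffree S) M _ _ (quot_bilin v (U := U)) bil).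
exists g => t s; rewrite /g /= /quot_bilin [LHS]ffree_comb.
by rewrite (reprE s (ffree_gen t)) // /ffree_ext ffree_comb.
Qed.

Variables (R : realType) (l : nat) (I : finType).
Variable f : I -> 'Hom('rV[R]_l, R^o).
Local Notation face := (face f).
Implicit Types (C D E F G : face) (u v d e : ffree face).

Let amul u v : ffree face :=
  \sum_(F : face) \sum_(G : face) ((u F : K) * (v G : K)) *: ffree_gen (fmul F G).

Let amulBl u v d : amul (u - v) d = amul u d - amul v d.
Proof.
rewrite /amul -sumrB; apply: eq_bigr => F _; rewrite -sumrB.
apply: eq_bigr => G _; rewrite -scalerBl; congr (_ *: _).
by rewrite !ffunE mulrBl.
Qed.

Let foldl_amulB u v ds :
  foldl amul (u - v) ds = foldl amul u ds - foldl amul v ds.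
Proof. by elim: ds u v => [|d ds IH] u v //=; rewrite amulBl IH. Qed.

Let amul_gen C d : amul (ffree_gen C) d =
  \sum_G (d G : K) *: ffree_gen (fmul C G).
Proof.
rewrite /amul (bigD1 C) //= [X in _ + X]big1 ?addr0 => [|F /negPf FC].
  by apply: eq_bigr => G _; rewrite ffree_genE eqxx mul1r.
by rewrite big1 // => G _; rewrite ffree_genE FC mul0r scale0r.
Qed.

Let amul_genB C d e :
  amul (ffree_gen C) (d - e) = amul (ffree_gen C) d - amul (ffree_gen C) e.
Proof.
rewrite !amul_gen -sumrB; apply: eq_bigr => G _.
by rewrite -scalerBl !ffunE.
Qed.

Let foldl_diff_prod C gs :
  foldl amul (ffree_gen C) [seq ffree_gen F - ffree_gen (fopp F) | F <- gs] =
  diff_prod (@ffree_gen face) C gs.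
Proof.
elim: gs C => [|G gs IH] C //=.
by rewrite amul_genB !amul_gen !(ffree_comb (fun G => ffree_gen (fmul C G)))
  foldl_amulB !IH.
Qed.

Definition chamber_gen (D : face) : ffree (chamber f) :=
  [ffun C => (val C == D)%:R].

Lemma foldl_amul_diff_prod C gs : [ffun D : chamber f => foldl amul (ffree_gen C)
    [seq ffree_gen F - ffree_gen (fopp F) | F <- gs] (val D)] =
  diff_prod chamber_gen C gs.
Proof.
rewrite foldl_diff_prod; elim: gs C => [|G gs IH] C /=.
  by apply/ffunP => D; rewrite !ffunE.
by rewrite -!IH; apply/ffunP => D; rewrite !ffunE.
Qed.

End FreeModules.

(** * Existence and values of [phi] *)

Section PhiExists.
Variables (R : realType) (l : nat) (I : finType).
Local Notation W := 'rV[R]_l.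
Local Notation Wdual := 'Hom('rV[R]_l, R^o).
Variable f : I -> Wdual.
Local Notation face := (face f).
Variable o : {vspace W} -> pred (seq Wdual).
Hypothesis fo : orients f o.
Local Notation ratf := (ratf f).
Implicit Types (F G C D E : face).

Definition chamber_vec : face -> V f := @chamber_gen ratf R l I f.

Lemma chamber_vec_gen (C : chamber f) : chamber_vec (val C) = gen f C.
Proof. by apply/ffunP => D; rewrite !ffunE val_eqE. Qed.

Lemma b_diff_prod p (u : p.+1.-tuple face) :
  b u = diff_prod chamber_vec (tnth u ord_max) (rev (take p u)).
Proof. exact: (@foldl_amul_diff_prod ratf). Qed.

Section Fixed.
Variables (p : nat) (X : {vspace W}).
Hypotheses (LX : X \in lattice f [set: I]) (cX : codim X = p).
Local Notation flagX := (flag f p (loc f X)).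
Local Notation FlX := (Fl f p (loc f X)).
Local Notation VX := (free_mod f (chamber_on f X)).

Lemma feps_flag_sign (u : p.+1.-tuple face) : is_fflag u ->
  feps o u = flag_sign o ratf (tnth u ord_max) (rev (take p u)).
Proof.
move=> /andP[_ /(sortedP (fone f)) su]; pose n := nth (fone f) u.
have step k : (k < p)%N -> fmul (n k.+1) (n k) = n k.
  move=> kp; apply/eqP; rewrite -fleP.
  by have /andP[] : flt (n k) (n k.+1) by apply: su; rewrite size_tuple.
have -> : feps o u = \prod_(i < p) eps o (n i) (n i.+1).
  by apply: eq_bigr => i _; rewrite !(tnth_nth (fone f)).
rewrite (tnth_nth (fone f)) -/(n _) /=.
suff h k : (k <= p)%N -> \prod_(i < k) eps o (n i) (n i.+1) =
    flag_sign o ratf (n k) (rev (take k u)) by rewrite h.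
elim: k => [|k IH] kp; first by rewrite big_ord0 take0.
rewrite big_ord_recr /= IH 1?ltnW // (take_nth (fone f)) ?size_tuple 1?ltnW //.
by rewrite rev_rcons /= -/(n k) step // mulrC.
Qed.

(** The sum over flags of faces is symmetric in the choices, so that it only
    remains to see that it kills the relations. *)
Lemma phi_exists : exists g : {bilinear FlX -> VX -> V f}, is_phi o g.
Proof.
have [|g gE] := @quot_bilin_ex ratf _ _ (V f)
    (fun (t : flagX) (C : chamber_on f X) =>
       flag_sum o chamber_vec (val C) (flag_terms t)) (relators f p (loc f X)).
  move=> r C /allpairsP[[t i] /= [_ ip ->]].
  rewrite ffree_ext_sum; apply: (relator_sum LX cX).
    have := flag_sum_kills fo chamber_vec (val C).
    by rewrite (eqP (valP C)).
  by move: ip; rewrite mem_filter => /andP[].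
exists g => t C u fu su uC; rewrite [LHS]gE b_diff_prod (feps_flag_sign fu) -uC.
have ysE : flag_terms t = [seq supp G | G <- rev (take p u)].
  rewrite /flag_terms map_rev map_take; congr (rev (take p _)).
  apply: (@eq_from_nth _ fullv); rewrite size_flag_seq ?size_map ?size_tuple //.
  move=> i ip; rewrite -(flag_atE t (Ordinal ip)) -su (tnth_nth (fone f)).
  by rewrite (nth_map (fone f)) ?size_tuple.
rewrite ysE flag_sum_diff_prod // -ysE uC (eqP (valP C)).
exact: flag_terms_below.
Qed.

Lemma fflag_ex C ys : flag_below f (supp C) ys -> exists2 gs,
  [seq supp G | G <- gs] = ys & path (fun E F => flt F E) C gs.
Proof.
elim: ys C => [|Y ys IH] C /=; first by exists [::].
move=> /and3P[LY cY h]; have [G GY] := face_on LY.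
have sG : supp (fmul C G) = Y by rewrite supp_mul GY ?coverS.
have [|gs gsE pgs] := IH (fmul C G); first by rewrite sG.
exists (fmul C G :: gs); rewrite /= ?sG ?gsE // pgs andbT /flt fleP fmulA fmulid.
rewrite eqxx; apply: contraTneq cY => E; rewrite -sG E.
by rewrite /cover (ltn_eqF (ltnSn _)) andbF.
Qed.

(** Every flag of subspaces is the flag of supports of some flag of faces that
    ends at [C], so that the characterization of [phi] gives all its values. *)
Lemma phiE (t : flagX) (C : chamber_on f X) :
  phi f o p X (flag_class t) (gen f C) = flag_sum o chamber_vec (val C) (flag_terms t).
Proof.
have [g0 g0P] := phi_exists.
have phiP : is_phi o (phi f o p X).
  by rewrite /phi; case: pselect => [ex|[]]; [case: cid | exists g0].
have CX := eqP (valP C).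
have h : flag_below f (supp (val C)) (flag_terms t) by rewrite CX flag_terms_below.
have [gs gsE pgs] := fflag_ex h.
have su : size (rcons (rev gs) (val C)) == p.+1.
  by rewrite size_rcons size_rev -(size_map (@supp R l I f)) gsE size_flag_terms.
pose u := Tuple su.
have uE (i : 'I_p.+1) : supp (tnth u i) = flag_at t i.
  rewrite flag_atE flag_seqE // -gsE -[Y in rcons _ Y]CX -map_rev -map_rcons.
  by rewrite (nth_map (fone f)) ?(eqP su) // -(tnth_nth _ u).
have uC : tnth u ord_max = val C.
  rewrite (tnth_nth (fone f)) /= nth_rcons size_rev.
  by rewrite -(size_map (@supp R l I f)) gsE size_flag_terms // ltnn eqxx.
have fu : is_fflag u.
  apply/andP; split; last by rewrite /= -rev_cons rev_sorted.
  by apply/forallP => i; rewrite uE flag_atE flag_seq_codim // -ltnS.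
have pu : take p u = rev gs.
  rewrite /= -cats1 take_size_cat // size_rev.
  by rewrite -(size_map (@supp R l I f)) gsE size_flag_terms.
rewrite (phiP t C u) // b_diff_prod feps_flag_sign // pu revK uC -gsE.
by rewrite flag_sum_diff_prod // gsE.
Qed.

End Fixed.
End PhiExists.

(** * The walk acts on flags *)

Section WalkAction.
Variables (R : realType) (l : nat) (I : finType).
Local Notation W := 'rV[R]_l.
Local Notation Wdual := 'Hom('rV[R]_l, R^o).
Variable f : I -> Wdual.
Local Notation face := (face f).
Local Notation supps gs := [seq supp G | G <- gs].
Variable o : {vspace W} -> pred (seq Wdual).
Hypothesis fo : orients f o.
Variables (K : fieldType) (M : lmodType K).
Implicit Types (F G C D E : face) (X Y Z : {vspace W}) (h : face -> M).

Lemma face_of_pt F : face_of f (pt F) = F.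
Proof. by apply: face_eqP => i; rewrite sgn_face_of (sgn_pt i (ptP F)). Qed.

(** Let [Y] be the last term of the flag that contains [D]: the next factor
    G - -G cannot change the signs of [D], since [D] already lies off the
    hyperplane of [Y] that separates G from -G. *)
Lemma diff_prod_vanish h D X gs : X \in lattice f [set: I] ->
  (forall i, i \notin loc f X -> sgn D i != Zero) ->
  ~~ (supp D <= X)%VS -> flag_below f X (supps gs) -> diff_prod h D gs = 0.
Proof.
elim: gs D X => [|G gs IH] D X LX DN DX /=.
  by move=> /eqP XE; rewrite XE subvf in DX.
move=> /and3P[LY XY hY].
have LG := supp_lattice G.
have [DY|DY] := boolP (supp D <= supp G)%VS; last first.
  rewrite !(IH _ (supp G)) ?subrr // ?supp_mul_le ?(negPf DY) // => i iG.
    by rewrite sgnM; case: ifP => [_|->//]; rewrite sgn_opp sign_opp0 sgn_eq0.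
  by rewrite sgnM; case: ifP => [_|->//]; rewrite sgn_eq0.
have ptX : pt D \notin X by rewrite -(supp_face_of _ LX) face_of_pt.
have DG i : sgn D i = Zero -> i \in loc f (supp G).
  move=> Di; have iX : i \in loc f X.
    by apply: contraT => /DN; rewrite Di.
  rewrite mem_loc; apply: (cover_in XY _ (subvP DY _ (points_supp (ptP D))) ptX).
    by rewrite -mem_loc.
  by apply/eqP; rewrite -sign_of_eq0 -(sgn_pt i (ptP D)) Di.
have -> : fmul D G = D.
  by apply: face_eqP => i; rewrite sgnM; case: eqP => // e;
     rewrite e; apply/eqP; rewrite sgn_eq0 DG.
have -> : fmul D (fopp G) = D.
  by apply: face_eqP => i; rewrite sgnM; case: eqP => // e;
     rewrite e; apply/eqP; rewrite sgn_opp sign_opp0 sgn_eq0 DG.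
by rewrite subrr.
Qed.

Lemma eq_diff_prod_leaf h h' C gs : flag_below f (supp C) (supps gs) ->
  (forall D, supp D = fullv -> h D = h' D) -> diff_prod h C gs = diff_prod h' C gs.
Proof.
move=> + hh; elim: gs C => [|G gs IH] C /=; first by move=> /eqP/hh.
move=> /and3P[_ /coverS CG hG].
by rewrite !IH // supp_mul ?supp_opp.
Qed.

Lemma diff_prod_linear (M' : lmodType K) (T : {linear M -> M'}) h C gs :
  T (diff_prod h C gs) = diff_prod (fun D => T (h D)) C gs.
Proof. by elim: gs C => [|G gs IH] C //=; rewrite linearB !IH. Qed.

Lemma flag_sum_linear (M' : lmodType K) (T : {linear M -> M'}) h C ys :
  T (flag_sum o h C ys) = flag_sum o (fun D => T (h D)) C ys.
Proof.
elim: ys C => [|Y ys IH] C //=; rewrite linear_sum; apply: eq_bigr => F _.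
by rewrite linearZ IH.
Qed.

Lemma diff_prod_sum (J : finType) (k : J -> K) (hh : J -> face -> M) C gs :
  diff_prod (fun D => \sum_j k j *: hh j D) C gs = \sum_j k j *: diff_prod (hh j) C gs.
Proof.
elim: gs C => [|G gs IH] C //=; rewrite !IH -sumrB; apply: eq_bigr => j _.
by rewrite scalerBr.
Qed.

Lemma faces_over_flag ys X : flag_below f X ys ->
  exists gs : seq face, supps gs = ys.
Proof.
elim: ys X => [|Y ys IH] X /=; first by exists [::].
move=> /and3P[LY _ /IH[gs <-]]; have [G <-] := face_on LY.
by exists (G :: gs).
Qed.

Variable wt : face -> K.

(** A face inside [supp C] only moves the end [C] of the flag; the other faces
    contribute nothing, by the preceding vanishing. *)
Lemma flag_sum_walk h (T : {linear M -> M}) C ys :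
  (forall D, supp D = fullv -> T (h D) = \sum_F wt F *: h (fmul F D)) ->
  flag_below f (supp C) ys ->
  T (flag_sum o h C ys) =
  \sum_(F | (supp F <= supp C)%VS) wt F *: flag_sum o h (fmul F C) ys.
Proof.
move=> TP hys; have [gs gsE] := faces_over_flag hys; rewrite -gsE in hys *.
rewrite flag_sum_diff_prod // linearZ /= diff_prod_linear (eq_diff_prod_leaf hys TP).
rewrite (diff_prod_sum wt (fun F D => h (fmul F D))) scaler_sumr.
rewrite (bigID (fun F => (supp F <= supp C)%VS)) /= addrC big1 ?add0r => [|F FC].
  apply: eq_bigr => F FC; have sF := supp_mul FC.
  rewrite -diff_prod_mul flag_sum_diff_prod ?sF // (flag_sign_indep fo K sF) ?sF //.
  by rewrite !scalerA mulrC.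
rewrite -diff_prod_mul (@diff_prod_vanish _ _ (supp C)) ?scaler0 ?supp_lattice //.
  by move=> i; rewrite -sgn_eq0 sgnM; case: ifP => [//|->].
by rewrite supp_mul_le ?supp_lattice // negb_and FC.
Qed.

End WalkAction.

(** * Sampling without replacement *)

Section Sampling.
Variables (R : realType) (l : nat) (I : finType).
Local Notation W := 'rV[R]_l.
Local Notation Wdual := 'Hom('rV[R]_l, R^o).
Variable f : I -> Wdual.
Local Notation face := (face f).
Variables (K : fieldType) (wt : face -> K).
Implicit Types (F G C D E : face) (S : {set face}).
Hypothesis wt_sum_neq0 : forall S, S != finset.set0 -> \sum_(F in S) wt F != 0.

Section Target.
Variable M : lmodType K.
Implicit Type h : face -> M.

(** The expectation of [h] at the product of the faces of [S], drawn one after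
    the other; the first draw is the leftmost factor. Each order has the weight
    of sampling without replacement, up to the product of all the weights. *)
Fixpoint draw n S h : M :=
  if n is n'.+1 then (\sum_(F in S) wt F)^-1 *:
    \sum_(F in S) draw n' (S :\ F) (fun D => h (fmul F D))
  else h (fone f).

Lemma eq_draw n S h h' : h =1 h' -> draw n S h = draw n S h'.
Proof.
elim: n S h h' => [|n IH] S h h' hh /=; first exact: hh.
by congr (_ *: _); apply: eq_bigr => F _; apply: IH => D; apply: hh.
Qed.

Lemma drawS n S h : draw n.+1 S h = (\sum_(F in S) wt F)^-1 *:
  \sum_(F in S) draw n (S :\ F) (fun D => h (fmul F D)).
Proof. by []. Qed.

Lemma wt_neq0 F : wt F != 0.
Proof.
have := wt_sum_neq0 (S := [set F]); rewrite big_set1; apply.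
by apply/set0Pn; exists F; rewrite inE.
Qed.

Lemma cardsD1_pred n S G : G \in S -> #|S| = n.+1 -> #|S :\ G| = n.
Proof. by move=> GS; rewrite (cardsD1 G) GS add1n => -[]. Qed.

(** In a product that starts with [G], the later occurrence of [G] is absorbed
    wherever it is drawn; summing over its place in the order gives the weight
    of the order where it is not drawn at all. *)
Lemma draw_mul n S G h : G \in S -> #|S| = n.+1 ->
  wt G *: draw n.+1 S (fun D => h (fmul G D)) =
  draw n (S :\ G) (fun D => h (fmul G D)).
Proof.
elim: n S h => [|n IH] S h GS cS.
  have /cards1P[F SF] : #|S| == 1%N by apply/eqP.
  move: GS; rewrite SF inE => /eqP ->.
  by rewrite /= !big_set1 scalerA mulfV ?wt_neq0 // scale1r fmulA fmulid.
have cSG : #|S :\ G| = n.+1 by apply: cardsD1_pred.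
have wS : \sum_(F in S) wt F != 0 by apply: wt_sum_neq0; apply/set0Pn; exists G.
set hG := fun D => h (fmul G D).
have wE : \sum_(F in S) wt F = wt G + \sum_(F in S :\ G) wt F.
  exact: (big_setD1 G GS).
have dE : \sum_(F in S) draw n.+1 (S :\ F) (fun D => hG (fmul F D)) =
    draw n.+1 (S :\ G) (fun D => hG (fmul G D)) +
    \sum_(F in S :\ G) draw n.+1 (S :\ F) (fun D => hG (fmul F D)).
  exact: (big_setD1 G GS).
rewrite drawS dE.
have -> : draw n.+1 (S :\ G) (fun D => hG (fmul G D)) = draw n.+1 (S :\ G) hG.
  by apply: eq_draw => D; rewrite /hG fmulA fmulid.
have -> : \sum_(F in S :\ G) draw n.+1 (S :\ F) (fun D => hG (fmul F D)) =
    (wt G)^-1 *: \sum_(F in S :\ G) draw n (S :\ G :\ F) (fun D => hG (fmul F D)).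
  rewrite scaler_sumr; apply: eq_bigr => F; rewrite !inE => /andP[FG FS].
  pose h' D := hG (fmul F D).
  have -> : draw n.+1 (S :\ F) h' = draw n.+1 (S :\ F) (fun D => h' (fmul G D)).
    apply: eq_draw => D; rewrite /h' /hG; congr h.
    by rewrite !fmulA fmul_aba.
  apply: (scalerI (wt_neq0 G)); rewrite IH.
  - rewrite scalerA mulfV ?wt_neq0 // scale1r.
    rewrite (_ : S :\ F :\ G = S :\ G :\ F).
      by apply: eq_draw => D; rewrite /h' /hG; congr h; rewrite !fmulA fmul_aba.
    by apply/setP => E; rewrite !inE andbCA.
  - by rewrite !inE eq_sym FG.
  - by apply: cardsD1_pred.
have wSG : \sum_(F in S :\ G) wt F != 0.
  by apply: wt_sum_neq0; rewrite -card_gt0 cSG.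
have -> : \sum_(F in S :\ G) draw n (S :\ G :\ F) (fun D => hG (fmul F D)) =
    (\sum_(F in S :\ G) wt F) *: draw n.+1 (S :\ G) hG.
  by rewrite drawS scalerA mulfV // scale1r.
rewrite wE in wS *; move: (draw n.+1 (S :\ G) hG) => A.
rewrite [(wt G)^-1 *: _]scalerA -[X in _ *: (_ *: (X + _))]scale1r -scalerDl.
rewrite !scalerA.
rewrite -[RHS]scale1r; congr (_ *: _).
by field; rewrite wt_neq0 wS.
Qed.

Lemma draw_eigen n S h : #|S| = n.+1 ->
  \sum_(G in S) wt G *: draw n.+1 S (fun D => h (fmul G D)) =
  (\sum_(G in S) wt G) *: draw n.+1 S h.
Proof.
move=> cS; rewrite [in RHS]/= scalerA mulfV ?scale1r; last first.
  by apply: wt_sum_neq0; rewrite -card_gt0 cS.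
by apply: eq_bigr => G GS; apply: draw_mul.
Qed.

Lemma draw_const n S (m : M) : #|S| = n ->
  draw n S (fun=> m) = (\prod_(F in S) wt F)^-1 *: m.
Proof.
elim: n S => [|n IH] S cS.
  by rewrite (cards0_eq cS) big_set0 invr1 scale1r.
have /set0Pn[G GS] : S != finset.set0 by rewrite -card_gt0 cS.
have cSG : #|S :\ G| = n by apply: cardsD1_pred.
apply: (scalerI (wt_neq0 G)).
have := draw_mul (fun=> m) GS cS => /= ->.
by rewrite IH // (big_setD1 G GS) /= invfM scalerA mulrA mulfV ?wt_neq0 // mul1r.
Qed.

(** A permutation is given by its value at 0 and by a permutation of the rest. *)
Lemma big_lift_perm n (T : 'S_n.+1 -> M) :
  \sum_s T s = \sum_(j : 'I_n.+1) \sum_(s : 'S_n) T (lift_perm ord0 j s).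
Proof.
pose g (js : 'I_n.+1 * 'S_n) := lift_perm ord0 js.1 js.2.
have g_inj : injective g.
  move=> [j s] [j' s'] /permP E; have := E ord0; rewrite /g !lift_perm_id /= => jj.
  rewrite -jj in E *; congr (_, _); apply/permP => k.
  by have := E (lift ord0 k); rewrite /g !lift_perm_lift => /lift_inj.
have g_bij : bijective g.
  apply: inj_card_bij g_inj _.
  by rewrite card_prod card_ord !card_Sn factS.
rewrite pair_big /= (reindex g) /=; last exact: onW_bij.
exact: eq_bigr.
Qed.

Lemma draw_perm n (e : 'I_n -> face) h : injective e ->
  draw n [set e i | i in 'I_n] h =
  \sum_(s : 'S_n) (\prod_(p < n) (\sum_(i < n | (p <= i)%N) wt (e (s i)))^-1) *:
    h (\big[@fmul R l I f/fone f]_(i < n) e (s i)).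
Proof.
elim: n e h => [|n IH] e h einj.
  rewrite (big_pred1 (perm_one 'I_0)) => [|s]; last by apply/esym/eqP/permP => -[].
  by rewrite !big_ord0 scale1r.
rewrite /= big_imset /=; last by move=> i j _ _ /einj.
rewrite big_imset /=; last by move=> i j _ _ /einj.
rewrite scaler_sumr (big_lift_perm (fun s : 'S_n.+1 => _ *: h _)).
apply: eq_big => [j|j _]; first by rewrite inE.
have -> : [set e i | i in 'I_n.+1] :\ e j = [set e (lift j i) | i in 'I_n].
  apply/setP => F; rewrite !inE; apply/andP/imsetP => [[Fj /imsetP[i _ FE]]|[i _ ->]].
    have [|k ik] := unlift_some (h := j) (i := i).
      by apply: contraNneq Fj => ->; rewrite FE.
    by move=> _; exists k; rewrite // FE ik.
  by rewrite (inj_eq einj) eq_sym neq_lift imset_f.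
rewrite IH; last by move=> i k /einj/lift_inj.
rewrite scaler_sumr; apply: eq_bigr => s _.
rewrite scalerA [\prod_(p < n.+1) _]big_ord_recl
  [\big[_/fone f]_(i < n.+1) _]big_ord_recl lift_perm_id; congr (_ *: _); last first.
  congr (h (fmul _ _)); apply: eq_bigr => i _; by rewrite lift_perm_lift.
congr (_ * _).
  congr (_^-1); rewrite (reindex_perm (lift_perm ord0 j s)) /=.
  by apply: eq_bigl => i; rewrite inE.
apply: eq_bigr => p _; congr (_^-1).
rewrite [RHS]big_mkcond big_ord_recl /= add0r [LHS]big_mkcond.
by apply: eq_bigr => i _; rewrite lift_perm_lift /= ltnS.
Qed.

End Target.

End Sampling.

(** * Galleries *)

Section Galleries.
Variables (R : realType) (l : nat) (I : finType).
Local Notation W := 'rV[R]_l.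
Local Notation Wdual := 'Hom('rV[R]_l, R^o).
Variable f : I -> Wdual.
Local Notation face := (face f).
Implicit Types (F G C D E : face) (X Y Z : {vspace W}).

Definition sep C D : {set I} := [set i | sgn C i != sgn D i].

Lemma sepP C D i : reflect (sgn C i = sgn D i) (i \notin sep C D).
Proof. by rewrite inE negbK; apply: eqP. Qed.

Lemma sep_eq0 C D : sep C D = finset.set0 -> C = D.
Proof.
by move=> CD; apply: face_eqP => i; apply/sepP; rewrite CD inE.
Qed.

Lemma sgn_mid (C D : face) (a b : R) i : 0 < a -> 0 < b -> sgn C i = sgn D i ->
  sign_of (f i (a *: pt C + b *: pt D) : R) = sgn C i.
Proof.
move=> a0 b0; rewrite (sgn_pt i (ptP C)) (sgn_pt i (ptP D)).
rewrite linearD !linearZ /= -![_ *: _]/(_ * _).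
move: (f i (pt C) : R) (f i (pt D) : R) => u v.
have [u0|u0|->] := ltgtP u 0; have [v0|v0|->] := ltgtP v 0;
  rewrite /sign_of ?eqxx ?mulr0 ?addr0 ?eqxx ?(lt_eqF u0) ?(gt_eqF u0) ?(lt_eqF v0)
    ?(gt_eqF v0) ?u0 ?v0 ?(lt_gtF u0) ?(lt_gtF v0) //= => _.
- have h : a * u + b * v < 0 by rewrite -oppr_gt0 opprD addr_gt0 // oppr_gt0 pmulr_rlt0.
  by rewrite (lt_eqF h) (lt_gtF h).
- have h : 0 < a * u + b * v by rewrite addr_gt0 // pmulr_rgt0.
  by rewrite (gt_eqF h) h.
Qed.

(** Let [E] be the face where the segment from [C] to [C'] crosses one of the
    hyperplanes between them. If all these hyperplanes meet the common support
    along the same subspace, then [E] is a wall of both faces; otherwise turning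
    around [E] leads to a third face strictly between them. *)
Lemma gallery_step C C' : supp C = supp C' -> C != C' ->
  (exists E, [/\ cover (supp E) (supp C), fmul E C = C & fmul E (fopp C) = C']) \/
  (exists D, [/\ supp D = supp C, (#|sep C D| < #|sep C C'|)%N
                & (#|sep D C'| < #|sep C C'|)%N]).
Proof.
move=> CC CN; have LC := supp_lattice C.
have /set0Pn[i iS] : sep C C' != finset.set0 by apply: contra CN => /eqP/sep_eq0->.
have loc_eq k : (sgn C k == Zero) = (sgn C' k == Zero) by rewrite !sgn_eq0 CC.
have sepN k : k \in sep C C' -> [/\ sgn C k != Zero, sgn C' k != Zero
    & sgn C' k = sign_opp (sgn C k)].
  by rewrite inE; have := loc_eq k; case: (sgn C k); case: (sgn C' k).
have [Ci C'i CC'i] := sepN i iS.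
(* Barycentric coordinates, up to scale, of the crossing point with [i]. *)
pose a : R := `|f i (pt C') : R|; pose b : R := `|f i (pt C) : R|.
have a0 : 0 < a by rewrite normr_gt0 -sign_of_eq0 -(sgn_pt i (ptP C')).
have b0 : 0 < b by rewrite normr_gt0 -sign_of_eq0 -(sgn_pt i (ptP C)).
pose z := a *: pt C + b *: pt C'; pose E := face_of f z.
have zX : z \in supp C.
  apply: rpredD; apply: rpredZ; first exact/points_supp/ptP.
  by rewrite CC; apply/points_supp/ptP.
have zi : (f i z : R) = 0.
  rewrite linearD !linearZ /= -![_ *: _]/(_ * _) /a /b.
  move: CC'i Ci; rewrite (sgn_pt i (ptP C)) (sgn_pt i (ptP C')).
  move: (f i (pt C) : R) (f i (pt C') : R) => u v; rewrite /sign_of.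
  have [u0|u0|->] := ltgtP u 0; have [v0|v0|->] := ltgtP v 0 => //= _ _.
  - by rewrite (ltr0_norm u0) (gtr0_norm v0); ring.
  - by rewrite (gtr0_norm u0) (ltr0_norm v0); ring.
have Eoff k : k \notin sep C C' -> sgn E k = sgn C k.
  by move=> /sepP e; rewrite sgn_face_of (sgn_mid a0 b0 e).
have EX : (supp E <= supp C)%VS by rewrite supp_face_of.
pose Xi := (supp C :&: hyp f i)%VS.
have LXi : Xi \in lattice f [set: I] by apply: lattice_capH.
have Ci' : ~~ (supp C <= hyp f i)%VS by rewrite -mem_loc -sgn_eq0.
have zXi : z \in Xi by rewrite memv_cap zX memv_ker zi eqxx.
have [/forallP allX|/forallPn[j jh]] :=
    boolP [forall j, (j \in sep C C') ==> (Xi <= hyp f j)%VS]; [left|right].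
  have E0 k : k \in sep C C' -> sgn E k = Zero.
    move=> kS; have := allX k; rewrite kS /= => /subvP/(_ z zXi).
    by rewrite memv_ker sgn_face_of => h; apply/eqP; rewrite sign_of_eq0.
  have sE : supp E = Xi.
    apply/eqP; rewrite eqEsubv supp_face_of // zXi /=.
    rewrite (lattice_sub LXi (supp_lattice E)); apply/fintype.subsetP => k.
    rewrite -sgn_eq0; have [kS _|kS] := boolP (k \in sep C C').
      by rewrite mem_loc; have := allX k; rewrite kS.
    rewrite Eoff // sgn_eq0 !mem_loc; apply: subv_trans; exact: capvSl.
  exists E; split; first by rewrite sE; apply: cover_capH.
    apply: face_eqP => k; rewrite sgnM; case: ifPn => // Ek.
    by apply: Eoff; apply: contra Ek => /E0->.
  apply: face_eqP => k; rewrite sgnM sgn_opp.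
  have [kS|kS] := boolP (k \in sep C C').
    by rewrite E0 // eqxx; have [_ _ ->] := sepN k kS.
  have e := sepP _ _ _ kS; rewrite Eoff // -e.
  by case: eqP => // ->.
move: jh; rewrite negb_imply => /andP[jS jX].
have [Cj C'j CC'j] := sepN j jS.
(* A direction in the hyperplane [i] that leads to the side of [C'] at [j]. *)
have [g gXi gj] : exists2 g, g \in Xi & sign_of (f j g : R) = sgn C' j.
  have /subvPn[g gXi] := jX; rewrite memv_ker => gj.
  have [|] := eqVneq (sign_of (f j g : R)) (sgn C' j); first by exists g.
  move=> gN; exists (- g); first by rewrite rpredN.
  rewrite linearN /=; move: gj gN C'j; rewrite /sign_of oppr_eq0 oppr_gt0.
  by case: (ltgtP (f j g : R) 0); case: (sgn C' j).
have gX : (supp (face_of f g) <= supp C)%VS.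
  by rewrite supp_face_of //; move: gXi; rewrite memv_cap => /andP[].
have gi : (f i g : R) = 0.
  by move: gXi; rewrite memv_cap memv_ker => /andP[_ /eqP].
have done D k1 k2 : k1 \in sep C C' -> k2 \in sep C C' ->
    supp D = supp C -> (forall k, k \notin sep C C' -> sgn D k = sgn C k) ->
    sgn D k1 = sgn C k1 -> sgn D k2 = sgn C' k2 ->
    [/\ supp D = supp C, (#|sep C D| < #|sep C C'|)%N
      & (#|sep D C'| < #|sep C C'|)%N].
  move=> k1S k2S sD off D1 D2; split=> //; apply: proper_card; apply/properP; split.
  - apply/fintype.subsetP => k; apply: contraTT => kS.
    by apply/sepP; rewrite off.
  - by exists k1 => //; apply/sepP.
  - apply/fintype.subsetP => k; apply: contraTT => kS.
    by apply/sepP; rewrite off //; apply/sepP.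
  - by exists k2 => //; apply/sepP.
have Ei : sgn E i = Zero by apply/eqP; rewrite sgn_face_of sign_of_eq0 zi.
have [Ej|Ej] := eqVneq (sgn E j) (sgn C j).
  exists (fmul E C'); apply: (done _ j i) => //.
  - by rewrite supp_mul // -CC.
  - move=> k kS; rewrite sgnM Eoff //; have := sepP _ _ _ kS => <-.
    by case: eqP.
  - by rewrite sgnM Ej (negPf Cj).
  - by rewrite sgnM Ei eqxx.
exists (fmul E (fmul (face_of f g) C)); apply: (done _ i j) => //.
- by rewrite !supp_mul ?supp_mul.
- move=> k kS; rewrite sgnM Eoff //; case: eqP => // Ck.
  rewrite sgnM Ck; case: eqP => // gk; exfalso; apply: gk.
  apply/eqP; rewrite sgn_eq0; move: gX; rewrite supp_le // => /fintype.subsetP.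
  by apply; rewrite -sgn_eq0 Ck.
- by rewrite sgnM Ei eqxx sgnM sgn_face_of gi /sign_of eqxx.
have [Ej0|Ej0] := eqVneq (sgn E j) Zero; rewrite sgnM ?Ej0 ?eqxx ?(negPf Ej0).
  by rewrite sgnM sgn_face_of gj (negPf C'j).
by move: Ej Ej0 Cj CC'j; case: (sgn E j); case: (sgn C j); case: (sgn C' j).
Qed.

End Galleries.

(** * Eigenvectors *)

Section Eigenvectors.
Variables (R : realType) (l : nat) (I : finType).
Local Notation W := 'rV[R]_l.
Local Notation Wdual := 'Hom('rV[R]_l, R^o).
Variable f : I -> Wdual.
Local Notation face := (face f).
Variable o : {vspace W} -> pred (seq Wdual).
Hypothesis fo : orients f o.
Variables (K : fieldType) (wt : face -> K).
Hypothesis wt_sum_neq0 :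
  forall S : {set face}, S != finset.set0 -> \sum_(F in S) wt F != 0.
Implicit Types (F G C D E : face) (X Y Z : {vspace W}).

(** The coefficient [q], for arbitrary weights. *)
Definition sample_wt X (C : chamber_on f X) : K :=
  let N := #|faces_on f X| in
  let Fs := fun i : 'I_N => enum_val i in
  \sum_(s : 'S_N | val C == \big[@fmul R l I f/fone f]_(i < N) Fs (s i))
    \prod_(p < N) (\sum_(i < N | (p <= i)%N) wt (Fs (s i)))^-1.

Lemma sgn_prod (r : seq face) i :
  (sgn (\big[@fmul R l I f/fone f]_(F <- r) F) i == Zero) =
  all (fun F => sgn F i == Zero) r.
Proof.
elim: r => [|F r IH]; first by rewrite big_nil sgn1.
by rewrite big_cons sgnM /=; case: ifP => // ->.
Qed.

Lemma supp_prod_faces_on X (r : seq face) : X \in lattice f [set: I] ->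
  r =i faces_on f X -> supp (\big[@fmul R l I f/fone f]_(F <- r) F) = X.
Proof.
move=> LX rX; apply: (lattice_eq (supp_lattice _) LX); apply/setP => i.
rewrite -sgn_eq0 sgn_prod; have [G GX] := face_on LX.
apply/allP/idP => [h|iX F]; first by rewrite -GX -sgn_eq0 h // rX inE GX.
by rewrite rX inE supp_le // sgn_eq0 => /fintype.subsetP; apply.
Qed.

Section Target.
Variable M : lmodType K.
Implicit Type h : face -> M.

Lemma sum_sample_wt X h : X \in lattice f [set: I] ->
  \sum_(C : chamber_on f X) sample_wt C *: h (val C) =
  draw wt #|faces_on f X| (faces_on f X) h.
Proof.
move=> LX; have SE : [set enum_val i | i in 'I_#|faces_on f X|] = faces_on f X.
  apply/setP => F; apply/imsetP/idP => [[i _ ->]|FX]; first exact: enum_valP.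
  by exists (enum_rank_in FX F); rewrite // enum_rankK_in.
rewrite -[S in draw _ _ S]SE (draw_perm wt); last exact: enum_val_inj.
rewrite /sample_wt; under eq_bigr do rewrite scaler_suml.
rewrite (exchange_big_dep xpredT) //=; apply: eq_bigr => s _.
have sX : supp (\big[@fmul R l I f/fone f]_(i < #|faces_on f X|) enum_val (s i)) == X.
  rewrite -(big_map (fun i => enum_val (s i)) xpredT id).
  apply/eqP/supp_prod_faces_on => // F; apply/mapP/idP => [[i _ ->]|FX].
    exact: enum_valP.
  exists ((s^-1)%g (enum_rank_in FX F)); first by rewrite mem_index_enum.
  by rewrite permKV enum_rankK_in.
by rewrite (big_pred1 (exist (fun F : face => supp F == X) _ sX : chamber_on f X)).
Qed.

Variables (h : face -> M).

Definition eigvec X ys : M :=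
  \sum_(C : chamber_on f X) sample_wt C *: flag_sum o h (val C) ys.

Lemma faces_on_card X : X \in lattice f [set: I] ->
  exists n, #|faces_on f X| = n.+1.
Proof.
move=> /face_on[F FX]; exists #|faces_on f X|.-1; rewrite prednK //.
by apply/card_gt0P; exists F; rewrite inE FX.
Qed.

(** The walk multiplies the end of a flag by the faces inside [X], and sampling
    without replacement is stationary for this restricted walk. *)
Lemma eigvecP (T : {linear M -> M}) X ys : X \in lattice f [set: I] ->
  (forall D, supp D = fullv -> T (h D) = \sum_F wt F *: h (fmul F D)) ->
  flag_below f X ys ->
  T (eigvec X ys) = (\sum_(F in faces_on f X) wt F) *: eigvec X ys.
Proof.
move=> LX TP hys; rewrite /eigvec.
rewrite (sum_sample_wt (fun D => flag_sum o h D ys)) //.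
have [n cX] := faces_on_card LX; rewrite cX -draw_eigen // -cX.
rewrite -(sum_sample_wt (fun D => flag_sum o h D ys)) // linear_sum /=.
transitivity (\sum_(C : chamber_on f X) \sum_(F in faces_on f X)
    wt F *: (sample_wt C *: flag_sum o h (fmul F (val C)) ys)).
  apply: eq_bigr => C _; rewrite linearZ /=.
  rewrite (flag_sum_walk fo TP) ?(eqP (valP C)) // scaler_sumr.
  apply: eq_big => [F|F _]; first by rewrite inE.
  by rewrite !scalerA mulrC.
rewrite exchange_big /=; apply: eq_bigr => G _; rewrite -scaler_sumr.
by rewrite (sum_sample_wt (fun D => flag_sum o h (fmul G D) ys)).
Qed.

End Target.

(** The total mass is the inverse of the product of all the weights. *)
Lemma sum_sample_wt_neq0 X : X \in lattice f [set: I] ->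
  \sum_(C : chamber_on f X) sample_wt C != 0.
Proof.
move=> LX; have := sum_sample_wt (M := K^o) (fun=> 1) LX.
under eq_bigr do rewrite [_ *: _]mulr1.
move=> ->; rewrite draw_const // [_ *: _]mulr1 invr_eq0.
apply/prodf_neq0 => F _; exact: wt_neq0.
Qed.

(** * Every vector is a combination of eigenvectors *)

Section Spanning.
Variables (M : lmodType K) (h : face -> M) (P : M -> Prop).
Hypotheses (P0 : P 0) (PD : forall u v, P u -> P v -> P (u + v))
  (PZ : forall k u, P u -> P (k *: u)).
Hypothesis Peig : forall X ys, X \in lattice f [set: I] -> flag_below f X ys ->
  P (eigvec h X ys).

Let Psum (J : finType) (F : J -> M) : (forall j, P (F j)) -> P (\sum_j F j).
Proof. by move=> PF; elim/big_ind: _. Qed.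

(** Two faces with the same support and a common wall [E] differ by the image of
    a flag that ends at [E]; by induction on the dimension of the support, the
    vectors of all the faces of a support thus agree modulo [P], hence with a
    multiple of their weighted sum, the eigenvector. *)
Lemma flag_sum_spanned C ys : flag_below f (supp C) ys -> P (flag_sum o h C ys).
Proof.
have [n] := ubnP (\dim (supp C)); elim: n => // n IH in C ys *.
move=> dC hys; set X := supp C.
have conn C1 C2 : supp C1 = X -> supp C2 = X ->
    P (flag_sum o h C1 ys - flag_sum o h C2 ys).
  have [m] := ubnP #|sep C1 C2|; elim: m => // m IHm in C1 C2 *.
  move=> le s1 s2; have [->|CN] := eqVneq C1 C2; first by rewrite subrr.
  have [[E [EC C1E C2E]]|[D [sD l1 l2]]] := gallery_step (etrans s1 (esym s2)) CN.
    have hE : flag_below f (supp E) (X :: ys).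
      by rewrite /= supp_lattice -s1 EC s1.
    have := @IH E (X :: ys).
    rewrite -s1 (flag_sum_cons fo) // C1E C2E s1 => /(_ _ hE) PE.
    have {}PE := PZ (pm1 K (agree o C1 E)) (PE _).
    rewrite scalerA pm12 scale1r in PE; apply: PE.
    by case/andP: EC => _ /eqP; rewrite s1 => dX; rewrite -ltnS -dX.
  rewrite -(subrK (flag_sum o h D ys) (flag_sum o h C1 ys)) -addrA.
  apply: PD; apply: IHm; rewrite ?sD //.
    exact: leq_trans l1 _.
  exact: leq_trans l2 _.
have LX := supp_lattice C.
have q0 := sum_sample_wt_neq0 LX; set q := \sum_C _ in q0.
have -> : flag_sum o h C ys = q^-1 *: (eigvec h X ys +
    \sum_(C' : chamber_on f X) sample_wt C' *:
      (flag_sum o h C ys - flag_sum o h (val C') ys)).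
  rewrite /eigvec -big_split /=; under eq_bigr do rewrite -scalerDr addrC subrK.
  by rewrite -scaler_suml scalerA mulVf // scale1r.
apply/PZ/PD; first exact: Peig.
by apply: Psum => C'; apply/PZ/conn => //; apply: (eqP (valP C')).
Qed.

End Spanning.
End Eigenvectors.

(** * Functionals on flags *)

Section Functionals.
Variables (R : realType) (l : nat) (I : finType).
Local Notation W := 'rV[R]_l.
Local Notation Wdual := 'Hom('rV[R]_l, R^o).
Variable f : I -> Wdual.
Local Notation face := (face f).
Local Notation supps gs := [seq supp G | G <- gs].
Local Notation hyp := (hyp f).
Variable o : {vspace W} -> pred (seq Wdual).
Hypothesis fo : orients f o.
Hypothesis f_neq0 : forall i, f i != 0.
Variable K : fieldType.
Implicit Types (F G C D E : face) (X Y Z : {vspace W}) (T : {set I}).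
Local Notation flag_sum := (flag_sum o).

Definition depends_on (M : Type) T (h : face -> M) := forall F F',
  (forall i, i \in T -> sgn F i = sgn F' i) -> h F = h F'.

Section Target.
Variable M : lmodType K.
Implicit Type h : face -> M.

Lemma diff_prod_agree T h C C' gs : depends_on T h ->
  (forall i, i \in T -> sgn C i = sgn C' i) -> diff_prod h C gs = diff_prod h C' gs.
Proof.
move=> hT; elim: gs C C' => [|G gs IH] C C' CC /=; first exact: hT.
by congr (_ - _); apply: IH => i iT; rewrite !sgnM CC.
Qed.

(** Each factor that has an effect makes one of the signs nonzero, hence fixed for
    the factors that follow, and there are more factors than signs. In the same
    way a difference operator of order [k] kills the polynomials of lower degree. *)
Lemma diff_prod_few T h C gs : depends_on T h ->
  (#|[set i in T | sgn C i == Zero]| < size gs)%N -> diff_prod h C gs = 0.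
Proof.
move=> hT; elim: gs C => // G gs IH C /=; rewrite ltnS => le.
have [|/exists_inP N] := boolP [exists i in T, (sgn C i == Zero) && (sgn G i != Zero)].
  move=> /exists_inP[i iT /andP[Ci Gi]].
  have sub G' : (sgn G' i != Zero) ->
      (#|[set j in T | sgn (fmul C G') j == Zero]| < size gs)%N.
    move=> G'i; apply: leq_trans le; apply: proper_card; apply/properP; split.
      apply/fintype.subsetP => j; rewrite !inE sgnM => /andP[-> /=].
      by case: ifP => // ->.
    exists i; first by rewrite inE iT Ci.
    by rewrite !inE sgnM Ci iT.
  by rewrite !IH ?subrr // sub // sgn_opp sign_opp0.
rewrite (@diff_prod_agree T h (fmul C G) (fmul C (fopp G))) ?subrr // => i iT.
rewrite !sgnM sgn_opp; case: ifP => // Ci.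
have /eqP -> // : sgn G i == Zero.
by apply: contraT => Gi; case: N; exists i; rewrite ?Ci.
Qed.

Lemma flag_sumZ k h C ys :
  flag_sum (fun D => k *: h D) C ys = k *: flag_sum h C ys.
Proof.
elim: ys C => [|Y ys IH] C //=; rewrite scaler_sumr; apply: eq_bigr => F _.
by rewrite IH !scalerA mulrC.
Qed.

Lemma eq_flag_sum_leaf h h' C ys : flag_below f (supp C) ys ->
  (forall D, supp D = fullv -> h D = h' D) -> flag_sum h C ys = flag_sum h' C ys.
Proof.
move=> hys hh; have [gs gsE] := faces_over_flag hys; rewrite -gsE in hys *.
by rewrite !flag_sum_diff_prod // (eq_diff_prod_leaf hys hh).
Qed.

Lemma kills_cons X Y (a : seq {vspace W} -> M) : Y \in lattice f [set: I] ->
  cover X Y -> kills_relators f X a ->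
  kills_relators f Y (fun ys => a (Y :: ys)).
Proof.
move=> LY XY ka ys1 Z ys2; rewrite -[RHS](ka (Y :: ys1) Z ys2).
by apply: eq_bigl => Y'; rewrite /= LY XY.
Qed.

(** Modulo the relations, the flags whose last but one term is not in a given
    hyperplane [i] through [X] generate: a last but one term in the hyperplane
    is first made to have its predecessor off the hyperplane, by induction, and
    is then the only such term of its relation. *)
Lemma kills_determined X i (a : seq {vspace W} -> M) ys :
  i \in loc f X -> kills_relators f X a ->
  (forall Y ys, flag_below f X (Y :: ys) -> i \notin loc f Y -> a (Y :: ys) = 0) ->
  flag_below f X ys -> a ys = 0.
Proof.
elim: ys X a => [|Y ys IH] X a iX ka a0 hys.
  move: iX; rewrite mem_loc (eqP hys) => /subvP h.
  case/eqP: (f_neq0 i); apply/lfunP => x; rewrite zero_lfunE; apply/eqP.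
  by rewrite -memv_ker h ?memvf.
have [iY|] := boolP (i \in loc f Y); last exact: a0.
have /and3P[LY XY hY] := hys.
apply: (IH Y (fun s => a (Y :: s))) => //; first exact: (kills_cons LY XY ka).
move=> Z zs hZ iZ; have /and3P[LZ YZ _] := hZ.
have hzs : flag_below f Z zs by case/and3P: hZ.
have := ka [::] Z zs; rewrite big_mkcond (bigD1_seq Y) ?undup_uniq ?mem_undup //=.
rewrite LY XY LZ YZ hzs /= big1 ?addr0 // => Y' YY'.
case: ifP => // /and4P[LY' XY' Y'Z _].
apply: a0; first by rewrite /= LY' XY' LZ Y'Z.
apply: contra YY' => iY'.
rewrite !mem_loc in iY iY' iZ.
by rewrite -(cover_eqcap Y'Z iY' iZ) (cover_eqcap YZ iY iZ).
Qed.

End Target.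

(** The analogue of the polynomials of degree [codim X] in the Heaviside functions
    of the hyperplanes through [X]: only the leading terms are felt by the flags,
    so that any function of the same signs is allowed. *)
Inductive local_poly X : (face -> K^o) -> Prop :=
| local_poly0 : local_poly X (fun=> 0)
| local_polyD h h' : local_poly X h -> local_poly X h' ->
    local_poly X (fun D => h D + h' D)
| local_poly_dep T h : depends_on T h -> (#|T| <= codim X)%N ->
    (\bigcap_(i in T) hyp i)%VS = X -> local_poly X h.

Lemma cap_loc T X i : (\bigcap_(i in T) hyp i)%VS = X -> i \in T -> i \in loc f X.
Proof. by move=> <- iT; rewrite mem_loc; apply: (bigcapv_inf i). Qed.

(** The hyperplanes of a term intersect in [X], hence they do not all contain
    another subspace of the same codimension, and too few signs are left. *)
Lemma local_poly_other X X' h C ys : X' \in lattice f [set: I] ->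
  local_poly X h -> supp C = X' -> codim X' = codim X -> X' != X ->
  flag_below f X' ys -> flag_sum h C ys = 0.
Proof.
move=> LX' gh CX cX XX' hys; elim: h / gh => [|h h' _ IH _ IH'|T h hT cT TX].
- by rewrite !flag_sum0.
- by rewrite !flag_sumD IH IH' addr0.
have [gs gsE] := faces_over_flag hys; rewrite -gsE in hys *.
rewrite !flag_sum_diff_prod ?CX // (diff_prod_few hT) ?scaler0 //.
rewrite -(size_map (@supp R l I f)) -(flag_below_codim hys) cX.
apply: leq_trans cT; apply: proper_card; apply/properP; split.
  by apply/fintype.subsetP => i; rewrite inE => /andP[].
have [/forallP a|/forallPn[i]] := boolP [forall i, (i \in T) ==> (sgn C i == Zero)].
  case/negP: XX'; rewrite eqEdim -TX; apply/andP; split.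
    apply/subv_bigcapP => i iT; have := a i.
    by rewrite iT sgn_eq0 CX mem_loc.
  by rewrite TX; move: cX; rewrite /codim; have := dim_le_l X; have := dim_le_l X'; lia.
by rewrite negb_imply => /andP[iT iC]; exists i; rewrite // inE iT (negPf iC).
Qed.

Lemma local_poly_cons X Y h i k :
  cover X Y -> local_poly Y h -> X \in lattice f [set: I] -> i \in loc f X -> i \notin loc f Y ->
  local_poly X (fun D => (k * (sgn D i == Pos)%:R : K) * h D).
Proof.
move=> XY gh LX iX iY; elim: h / gh => [|h h' _ IH _ IH'|T h hT cT TY].
- rewrite (_ : (fun D => _) = (fun=> 0)); first exact: local_poly0.
  by apply/funext => D; rewrite mulr0.
- rewrite (_ : (fun D => _) = (fun D => (k * (sgn D i == Pos)%:R : K) * h D +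
    (k * (sgn D i == Pos)%:R : K) * h' D)); first exact: local_polyD.
  by apply/funext => D; rewrite mulrDr.
apply: (@local_poly_dep _ (i |: T)).
- move=> F F' FF; congr (_ * _); first by rewrite FF // !inE eqxx.
  by apply: hT => j jT; apply: FF; rewrite !inE jT orbT.
- rewrite (cover_codim XY); apply: leq_trans (leq_card_setU _ _) _.
  by rewrite cards1 add1n ltnS.
have iT : i \notin T by apply: contra iY => /(cap_loc TY).
rewrite big_setU1 //= TY capvC (cover_eqcap XY) //; first by rewrite -mem_loc.
by rewrite -mem_loc.
Qed.

Lemma pos_face Y i : Y \in lattice f [set: I] -> i \notin loc f Y ->
  exists2 G : face, supp G = Y & sgn G i = Pos.
Proof.
move=> LY iY; have [G GY] := face_on LY.
rewrite -GY -sgn_eq0 in iY; case Gi: (sgn G i) iY => // _; last by exists G.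
by exists (fopp G); rewrite ?supp_opp // sgn_opp Gi.
Qed.

(** Multiplying by the indicator of the positive side of [i] keeps one of the two
    faces of support [Y'] next to [C], and what remains is the functional of [Y],
    which vanishes on the flags through the other subspaces. *)
Lemma represent_one X Y i (a : seq {vspace W} -> K^o) h :
  X \in lattice f [set: I] -> Y \in lattice f [set: I] -> cover X Y ->
  i \in loc f X -> i \notin loc f Y -> local_poly Y h ->
  (forall C ys, supp C = Y -> flag_below f Y ys -> a (Y :: ys) = flag_sum h C ys) ->
  exists2 h', local_poly X h' & forall C Y' ys, supp C = X ->
    flag_below f X (Y' :: ys) -> i \notin loc f Y' ->
    flag_sum h' C (Y' :: ys) = if Y' == Y then a (Y :: ys) else 0.
Proof.
move=> LX LY XY iX iY gh ha.
have [G GY Gi] := pos_face LY iY; have [C0 C0X] := face_on LX.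
pose k : K := pm1 K (agree o (fmul C0 G) C0).
pose hh : face -> K^o := fun D => (k * (sgn D i == Pos)%:R : K) * h D.
exists hh.
  exact: (local_poly_cons k XY gh LX iX iY).
move=> C Y' ys CX hys iY'.
have [LY' XY' hY'] := and3P hys.
have [G' [G'Y G'i GG]] : exists G', [/\ supp G' = Y', sgn G' i = Pos
    & Y' = Y -> G' = G].
  have [YY|YN] := eqVneq Y' Y; first by exists G; rewrite YY.
  by have [G' ? ?] := pos_face LY' iY'; exists G'; split=> // /eqP; rewrite (negPf YN).
have Ci : sgn C i = Zero by apply/eqP; rewrite sgn_eq0 CX.
have CG : cover (supp C) (supp G') by rewrite CX G'Y.
have sG : supp (fmul C G') = Y' by rewrite supp_mul ?coverS.
rewrite -G'Y flag_sum_cons //.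
have -> : flag_sum hh (fmul C (fopp G')) ys = 0.
  rewrite -[RHS](flag_sum0 o K^o (fmul C (fopp G')) ys); apply: eq_flag_sum => D <-.
  by rewrite /hh !sgnM Ci sgn_opp G'i /= mulr0 mul0r.
have -> : flag_sum hh (fmul C G') ys = k *: flag_sum h (fmul C G') ys.
  rewrite -flag_sumZ; apply: eq_flag_sum => D <-.
  by rewrite /hh !sgnM Ci G'i /= mulr1.
rewrite subr0.
rewrite G'Y; case: eqP => [YY|YN].
  rewrite -ha ?sG -?YY // (GG YY) scalerA.
  rewrite (agree_indep fo (C' := C0)) ?CX ?C0X -?(GG YY) ?G'Y ?XY' //.
  by rewrite (GG YY) -/k /k pm12 scale1r.
rewrite (@local_poly_other Y Y' h) ?scaler0 //; last exact/eqP.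
by move: (cover_codim XY) (cover_codim XY') => -> [->].
Qed.

(** This is the reason for injectivity: the images of the flags cannot satisfy
    more relations than the flags. Fixing a hyperplane [i] through [X], it is
    enough to match the values on the flags whose last but one term is not in
    [i], and these are matched one such term at a time, by induction. *)
Lemma represent X (a : seq {vspace W} -> K^o) :
  X \in lattice f [set: I] -> kills_relators f X a ->
  exists2 h, local_poly X h & forall C ys, supp C = X -> flag_below f X ys ->
    a ys = flag_sum h C ys.
Proof.
have [n] := ubnP (codim X); elim: n => // n IH in X a *; rewrite ltnS => cX LX ka.
have [X1|XN] := eqVneq X fullv.
  exists (fun=> a [::]).
    apply: (@local_poly_dep _ finset.set0) => //; first by rewrite cards0.
    by rewrite big_set0.
  move=> C ys CX /flag_below_codim; rewrite X1 codim_fullv.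
  by case: ys.
have [i iX] : exists i, i \in loc f X.
  apply/set0Pn; apply: contra XN => /eqP X0.
  by rewrite (lattice_loc LX) X0 big_set0.
pose good Y := [&& Y \in lattice f [set: I], cover X Y & i \notin loc f Y].
have [h gh hE] : exists2 h, local_poly X h & forall C Y ys, supp C = X ->
    flag_below f X (Y :: ys) -> i \notin loc f Y ->
    flag_sum h C (Y :: ys) =
    if Y \in [seq Y <- undup (lattice f [set: I]) | good Y] then a (Y :: ys) else 0.
  have : uniq [seq Y <- undup (lattice f [set: I]) | good Y].
    by rewrite filter_uniq ?undup_uniq.
  have : all good [seq Y <- undup (lattice f [set: I]) | good Y] := filter_all _ _.
  elim: [seq Y <- _ | _] => [|Y s IHs].
    by exists (fun=> 0); [exact: local_poly0 | move=> *; rewrite flag_sum0].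
  rewrite [all _ _]/= [uniq _]/= => /andP[/and3P[LY XY iY] /IHs{}IHs].
  move=> /andP[Ys /IHs[h gh hE]].
  have [|hY gY hYE] := IH Y (fun ys => a (Y :: ys)) _ LY (kills_cons LY XY ka).
    by rewrite (cover_codim XY) in cX.
  have [h' gh' h'E] := represent_one LX LY XY iX iY gY hYE.
  exists (fun D => h' D + h D); first exact: local_polyD.
  move=> C Y' ys CX hys iY'; rewrite flag_sumD h'E // hE // inE.
  by case: eqP => [->|_]; rewrite ?(negPf Ys) ?addr0 ?add0r.
exists h => // C ys CX hys; apply/eqP; rewrite -subr_eq0; apply/eqP.
apply: (@kills_determined K^o X i (fun ys => a ys - flag_sum h C ys)) => //.
  move=> ys1 Z ys2; rewrite sumrB ka sub0r -CX flag_sum_kills // oppr0.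
  by [].
move=> Y zs hY iY; rewrite hE // mem_filter mem_undup /good iY.
by have /and3P[-> -> _] := hY; rewrite /= subrr.
Qed.

End Functionals.

(** * The eigenspaces over a general field of coefficients *)

Section Eigenspaces.
Variables (R : realType) (l : nat) (I : finType).
Local Notation W := 'rV[R]_l.
Local Notation Wdual := 'Hom('rV[R]_l, R^o).
Variable f : I -> Wdual.
Local Notation face := (face f).
Variable o : {vspace W} -> pred (seq Wdual).
Hypothesis fo : orients f o.
Hypothesis f_neq0 : forall i, f i != 0.
Variables (K : fieldType) (wt : face -> K).
Hypothesis wt_inj : forall S S' : {set face},
  \sum_(F in S) wt F = \sum_(F in S') wt F -> S = S'.
Local Notation VK := (ffree K (chamber f)).
Local Notation h := (@chamber_gen K R l I f).
Variable A : {linear VK -> VK}.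
Hypothesis AP : forall D, supp D = fullv -> A (h D) = \sum_F wt F *: h (fmul F D).
Implicit Types (F G C D E : face) (X Y Z : {vspace W}) (v : VK).

Let wt_sum_neq0 (S : {set face}) : S != finset.set0 -> \sum_(F in S) wt F != 0.
Proof.
apply: contraNneq => S0; apply/eqP/wt_inj; rewrite S0.
by rewrite big_set0.
Qed.

Definition eigval X : K := \sum_(F in faces_on f X) wt F.

Lemma eigval_inj X Y : X \in lattice f [set: I] -> Y \in lattice f [set: I] ->
  eigval X = eigval Y -> X = Y.
Proof.
move=> LX LY /wt_inj/setP XY; have [F FX] := face_on LX; have [G GY] := face_on LY.
apply/eqP; rewrite eqEsubv; have := XY F; have := XY G; rewrite !inE FX GY !subvv.
by move=> -> <-.
Qed.

Local Notation flagsX X := (flag f (codim X) (loc f X)).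
Local Notation eigv X := (fun t : flagsX X => eigvec o wt h X (flag_terms t)).

Lemma eigvec_eigen X (a : ffree K (flagsX X)) : X \in lattice f [set: I] ->
  A (ffree_ext (eigv X) a) = eigval X *: ffree_ext (eigv X) a.
Proof.
move=> LX; rewrite /ffree_ext linear_sum scaler_sumr; apply: eq_bigr => t _.
rewrite linearZ /= (eigvecP fo wt_sum_neq0 LX AP) ?flag_terms_below //.
by rewrite !scalerA mulrC.
Qed.

Let L := undup (lattice f [set: I]).

Let mem_L X : (X \in L) = (X \in lattice f [set: I]).
Proof. by rewrite mem_undup. Qed.

Lemma eigen_decomp v : exists vv : {vspace W} -> VK,
  (forall X, X \in L -> exists a, vv X = ffree_ext (eigv X) a) /\
  v = \sum_(X <- L) vv X.
Proof.
pose P v := exists vv : {vspace W} -> VK,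
  (forall X, X \in L -> exists a, vv X = ffree_ext (eigv X) a) /\
  v = \sum_(X <- L) vv X.
have P0 : P 0.
  exists (fun=> 0); split=> [X _|]; last by rewrite big1.
  by exists 0; rewrite linear0.
have PD u1 u2 : P u1 -> P u2 -> P (u1 + u2).
  move=> [v1 [h1 ->]] [v2 [h2 ->]]; exists (fun X => v1 X + v2 X).
  split=> [X XL|]; last by rewrite big_split.
  have [a1 ->] := h1 X XL; have [a2 ->] := h2 X XL.
  by exists (a1 + a2); rewrite linearD.
have PZ k u : P u -> P (k *: u).
  move=> [v1 [h1 ->]]; exists (fun X => k *: v1 X).
  split=> [X XL|]; last by rewrite scaler_sumr.
  by have [a1 ->] := h1 X XL; exists (k *: a1); rewrite linearZ.
have Peig X ys : X \in lattice f [set: I] -> flag_below f X ys ->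
    P (eigvec o wt h X ys).
  move=> LX hys; have [t tE] := flag_of_ys LX erefl hys.
  exists (fun Y => if Y == X then eigvec o wt h X ys else 0); split=> [Y YL|].
    case: eqP => [->|_]; last by exists 0; rewrite linear0.
    by exists (ffree_gen K t); rewrite /ffree_ext ffree_comb tE.
  rewrite (bigD1_seq X) ?mem_L ?undup_uniq //= eqxx big1 ?addr0 // => Y.
  by move=> /negPf->.
rewrite -/(P v) (ffree_decomp v).
elim/big_ind: _ => // C _; apply: (PZ).
have -> : ffree_gen K C = h (val C).
  by apply/ffunP => D; rewrite !ffunE.
apply: (flag_sum_spanned fo wt_sum_neq0 P0 PD PZ Peig (C := val C) (ys := [::])).
by rewrite /=; apply/eqP/codim0/eqP/(valP C).
Qed.

(** Applying the product of the [A - eigval Y] over [Y != X] to the decomposition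
    of an eigenvector keeps only its component at [X], up to a nonzero factor,
    because the eigenvalues are distinct. *)
Lemma eigenspace_span X v : X \in lattice f [set: I] -> A v = eigval X *: v ->
  exists a, v = ffree_ext (eigv X) a.
Proof.
move=> LX Av; have [vv [vvP vE]] := eigen_decomp v.
pose B s u := foldr (fun Y u => A u - eigval Y *: u) u s.
have BD s u1 u2 : B s (u1 + u2) = B s u1 + B s u2.
  elim: s => //= Y s ->; rewrite linearD scalerDr opprD.
  by rewrite addrACA.
have B0 s : B s 0 = 0 by elim: s => //= Y s ->; rewrite linear0 scaler0 subrr.
have Beig s c u : A u = c *: u -> B s u = (\prod_(Y <- s) (c - eigval Y)) *: u.
  move=> Au; elim: s => [|Y s IH] /=; first by rewrite big_nil scale1r.
  by rewrite IH linearZ /= Au !scalerA -scalerBl big_cons; congr (_ *: _); ring.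
have vvA Y : Y \in L -> A (vv Y) = eigval Y *: vv Y.
  by move=> YL; have [a ->] := vvP Y YL; rewrite eigvec_eigen // -mem_L.
pose s := rem X L; pose c := \prod_(Y <- s) (eigval X - eigval Y).
have sE : s = [seq Y <- L | Y != X] by rewrite /s rem_filter ?undup_uniq.
have c0 : c != 0.
  rewrite /c prodf_seq_neq0; apply/allP => Y; rewrite sE mem_filter mem_L.
  move=> /andP[YX LY]; rewrite subr_eq0; apply: contra YX => /eqP e.
  by rewrite (eigval_inj LX LY e).
have XL : X \in L by rewrite mem_L.
have [a aE] := vvP X XL; exists a; rewrite -aE.
apply: (scalerI c0); rewrite -(Beig s _ _ Av) -(Beig s _ _ (vvA X XL)) {1}vE.
rewrite (big_morph (B s) (BD s) (B0 s)) (bigD1_seq X) ?undup_uniq //=.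
rewrite big_seq_cond big1 ?addr0 // => Y /andP[YL YX].
have Ys : Y \in s by rewrite sE mem_filter YX.
by rewrite (Beig s _ _ (vvA Y YL)) (big_rem _ Ys) /= subrr mul0r scale0r.
Qed.

Section Fixed.
Variables (p : nat) (X : {vspace W}).
Hypotheses (LX : X \in lattice f [set: I]) (cX : codim X = p).
Local Notation flagX := (flag f p (loc f X)).
Variable rels : seq (ffree K flagX).
Local Notation U := (<<rels>>%VS).
Hypothesis relsP : forall (t : flagX) (i : 'I_p.+1), (0 < i < p)%N ->
  \sum_(u : flagX | [forall j, (j != i) ==> (flag_at u j == flag_at t j)])
    ffree_gen K u \in U.
Variable g : {linear quotv U -> VK}.
Hypothesis gE : forall t : flagX,
  g (quotv_class U (ffree_gen K t)) = eigvec o wt h X (flag_terms t).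
Let e (t : flagX) := eigvec o wt h X (flag_terms t).

Lemma class_ext (a : ffree K flagX) : g (quotv_class U a) = ffree_ext e a.
Proof.
have class_lin k u1 u2 : quotv_class U (k *: u1 + u2) =
    k *: quotv_class U u1 + quotv_class U u2.
  by rewrite quotv_classD -quotv_scale_class.
have class0 : quotv_class U 0 = 0.
  by have := class_lin (-1) 0 0; rewrite scaleN1r addNr scaleN1r addNr.
rewrite [in LHS](ffree_decomp a) /ffree_ext.
elim/big_rec2: _ => [|t y1 y2 _ IH]; first by rewrite class0 linear0.
by rewrite class_lin linearP IH gE.
Qed.

Lemma image_eigenspace v : A v = eigval X *: v <-> exists x, g x = v.
Proof.
have gx x : g x = ffree_ext e (repr x) by rewrite -class_ext quotv_classE.
have span := eigenspace_span (v := v) LX; have eig := eigvec_eigen (X := X).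
rewrite cX in span eig; split=> [/span[a ->]|[x <-]].
  by exists (quotv_class U a); rewrite class_ext.
by rewrite gx eig.
Qed.

(** A vector of the kernel that is not a combination of relations would be
    detected by a functional on the flags; but every functional factors through
    the chambers. *)
Lemma kernel_rels (a : ffree K flagX) : ffree_ext e a = 0 -> a \in U.
Proof.
move=> a0; apply: contraT => aU.
pose pr (u : ffree K flagX) := u - projv U u.
have pr_lin : linear pr.
  by move=> k u1 u2; rewrite /pr linearP scalerBr opprD addrACA.
have prU u : u \in U -> pr u = 0 by move=> uU; rewrite /pr projv_id ?subrr.
have [t0 t0a] : exists t, pr a t != 0 :> K.
  have /eqP : pr a != 0.
    by apply: contra aU; rewrite subr_eq0 => /eqP->; apply: memv_proj.
  move=> pa; apply/existsP; apply: contra_notT pa => /existsPn pa0.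
  by apply/ffunP => t; have := pa0 t; rewrite negbK => /eqP->; rewrite ffunE.
pose al (u : ffree K flagX) : K^o := pr u t0.
have al_lin : linear al by move=> k u1 u2; rewrite /al pr_lin !ffunE.
pose alL : {linear ffree K flagX -> K^o} := HB.pack al
  (GRing.isLinear.Build K (ffree K flagX) K^o _ al al_lin).
(* The same functional, as a function of the terms of the flag. *)
pose be (ys : seq {vspace W}) : K^o :=
  if [pick t : flagX | flag_terms t == ys] is Some t then al (ffree_gen K t) else 0.
have beE t : be (flag_terms t) = al (ffree_gen K t).
  rewrite /be; case: pickP => [u /eqP/(flag_terms_inj LX cX)->//|/(_ t)].
  by rewrite eqxx.
have be_kills : kills_relators f X be.
  move=> ys1 Z ys2.
  have [/hasP[Y0 _ hY0]|/hasPn N] := boolP (has (fun Y =>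
      flag_below f X (ys1 ++ [:: Y, Z & ys2])) (undup (lattice f [set: I]))); last first.
    rewrite big_seq_cond big1 // => Y /andP[/N]; by move=> /negPf->.
  have [t tE] := flag_of_ys LX cX hY0.
  have sz : (size ys1 + (size ys2).+2)%N = p.
    by have := size_flag_terms t; rewrite tE size_cat.
  have ip : ((size ys2).+1 < p.+1)%N by lia.
  have ip' : (0 < Ordinal ip < p)%N by rewrite /=; lia.
  rewrite -(relator_sumE LX cX be ip' erefl tE).
  under eq_bigr do rewrite beE.
  rewrite -[LHS](linear_sum alL) /= /al prU ?ffunE //; exact: relsP.
have [hh _ hhE] := represent fo f_neq0 LX be_kills.
pose B := ffree_ext (fun C : chamber f => hh (val C)) : {linear VK -> K^o}.
have Bh D : supp D = fullv -> B (h D) = hh D.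
  move=> D1; have cD : is_chamber D by rewrite /is_chamber D1 codim_fullv.
  have -> : h D = ffree_gen K (Sub D cD : chamber f).
    by apply/ffunP => C; rewrite !ffunE.
  by rewrite /B /= /ffree_ext ffree_comb.
have Be t : B (e t) = (\sum_(C : chamber_on f X) sample_wt wt C) *: al (ffree_gen K t).
  rewrite /e /eigvec linear_sum scaler_suml; apply: eq_bigr => C _.
  have hC : flag_below f (supp (val C)) (flag_terms t).
    by rewrite (eqP (valP C)) flag_terms_below.
  rewrite linearZ /= flag_sum_linear (eq_flag_sum_leaf fo hC Bh) -beE.
  by rewrite (hhE (val C)) ?flag_terms_below //; apply: (eqP (valP C)).
have := congr1 B a0; rewrite linear0 /ffree_ext linear_sum /=.
have -> : \sum_t B ((a t : K) *: e t) =
    (\sum_(C : chamber_on f X) sample_wt wt C) *: al a.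
  rewrite [in RHS](ffree_decomp a) -[al]/(alL : _ -> _) linear_sum scaler_sumr.
  by apply: eq_bigr => t _; rewrite !linearZ /= Be !scalerA mulrC.
move=> /eqP; rewrite scaler_eq0 (negPf (sum_sample_wt_neq0 wt_sum_neq0 LX)) /=.
by rewrite /al (negPf t0a).
Qed.

Lemma eigenvectors_injective : injective g.
Proof.
move=> x y gxy; rewrite -[x]quotv_classE -[y]quotv_classE.
apply/quotv_classP/kernel_rels; rewrite linearB /= -!class_ext !quotv_classE.
by rewrite gxy subrr.
Qed.

End Fixed.
End Eigenspaces.

(** * Rational functions as coefficients *)

Lemma sum_mpolyX_inj (n : nat) (R : nzRingType) (S S' : {set 'I_n}) :
  \sum_(i in S) mpolyX R (mnm1 i) = \sum_(i in S') mpolyX R (mnm1 i) -> S = S'.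
Proof.
have E (T : {set 'I_n}) j :
    mcoeff (mnm1 j) (\sum_(i in T) mpolyX R (mnm1 i)) = (j \in T)%:R.
  rewrite raddf_sum /=.
  rewrite (eq_bigr (fun i => (i == j)%:R)) => [|i _]; last exact: mcoeffXU.
  have [jT|jT] := boolP (j \in T).
    rewrite (bigD1 j) //= eqxx big1 ?addr0 // => i /andP[_ /negPf->] //.
  by rewrite big1 // => i iT; case: eqP => // ij; rewrite -ij iT in jT.
move=> SS; apply/setP => j; have := E S j; rewrite SS E.
by case: (j \in S); case: (j \in S') => // /eqP; rewrite ?oner_eq0 // eq_sym oner_eq0.
Qed.

Section Weights.
Variables (R : realType) (l : nat) (I : finType).
Variable f : I -> 'Hom('rV[R]_l, R^o).

(** Sums of distinct indeterminates are distinct polynomials. *)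
Lemma sum_w_inj (S S' : {set face f}) :
  \sum_(F in S) w F = \sum_(F in S') w F -> S = S'.
Proof.
have E (T : {set face f}) : \sum_(F in T) w F =
    tofrac (\sum_(i in [set enum_rank F | F in T]) mpolyX R (mnm1 i)).
  rewrite raddf_sum big_imset //=; exact: in2W enum_rank_inj.
rewrite !E => /eqP; rewrite tofrac_eq => /eqP/sum_mpolyX_inj.
exact/imset_inj/enum_rank_inj.
Qed.

Lemma Kfun_chamber_vec (D : face f) : supp D = fullv ->
  Kfun (chamber_vec D) = \sum_F w F *: chamber_vec (fmul F D).
Proof.
move=> D1; have cD : is_chamber D by rewrite /is_chamber D1 codim_fullv.
pose C : chamber f := Sub D cD.
have -> : chamber_vec D = gen f C by rewrite -chamber_vec_gen.
rewrite /Kfun [LHS](ffree_comb (K := ratf f)).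
by apply: eq_bigr => F _; rewrite -chamber_vec_gen.
Qed.

Lemma mem_eigenspace (a : ratf f) (v : V f) :
  v \in passmx.leigenspace (K f) a <-> Kfun v = a *: v.
Proof.
rewrite /passmx.leigenspace memv_ker add_lfunE opp_lfunE scale_lfunE id_lfunE.
by rewrite lfunE subr_eq0; split=> /eqP.
Qed.

End Weights.

Theorem theorem3p6 (R : realType) (l : nat) (I : finType)
    (f : I -> 'Hom('rV[R]_l, R^o))
    (o : {vspace 'rV[R]_l} -> pred (seq 'Hom('rV[R]_l, R^o)))
    (p : nat) (X : {vspace 'rV[R]_l}) :
  is_arrangement f -> is_essential f -> orients f o ->
  (p <= l)%N -> X \in lattice f [set: I] -> codim X = p ->
  injective (@psi R l I f o p X) /\
  (forall v : V f, v \in passmx.leigenspace (K f) (lambda f X) <->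
                   exists x : Fl f p (loc f X), @psi R l I f o p X x = v).
Proof.
move=> [f0 _] _ fo _ LX cX.
have relsP (t : flag f p (loc f X)) (i : 'I_p.+1) : (0 < i < p)%N ->
    relator t i \in <<relators f p (loc f X)>>%VS.
  move=> ip; apply/memv_span/allpairsP; exists (t, i); split=> //=.
    by rewrite mem_enum.
  by rewrite mem_filter ip mem_enum.
have psiE (t : flag f p (loc f X)) : @psi R l I f o p X (flag_class t) =
    eigvec o (@w R l I f) (@chamber_vec R l I f) X (flag_terms t).
  by rewrite /psi; apply: eq_bigr => C _; rewrite phiE.
split.
  exact: (@eigenvectors_injective R l I f o fo f0 (ratf f) (@w R l I f) (@sum_w_inj R l I f)
   p X LX cX (relators f p (loc f X)) relsP (@psi R l I f o p X) psiE).
move=> v; rewrite mem_eigenspace.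
exact: (@image_eigenspace R l I f o fo (ratf f) (@w R l I f) (@sum_w_inj R l I f)
   (@Kfun R l I f) (@Kfun_chamber_vec R l I f)
   p X LX cX (relators f p (loc f X)) (@psi R l I f o p X) psiE).
Qed.
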